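(* Consider the single sample split Newey and Robins plug-in estimator $\hat\psi^{\mathrm{NR}}_k$ of $\psi(\mathbb P)=\mathbb E_{\mathbb P}[\mathrm{Cov}_{\mathbb P}(A,Y\mid X)]$ over $\mathcal P_{(\alpha,\beta)}$ defined in the context, and suppose we choose the prediction-optimal resolution $k=k_2^{\mathrm{pred}}$, where $k_2^{\mathrm{pred}}=c_2n^{\frac d{2\beta+d}}$ for fixed $c_2>0$. Then $\hat\psi^{\mathrm{NR}}_{k_2^{\mathrm{pred}}}$ is minimax rate optimal if and only if $\alpha\ge\frac d2$.
   Context: Notation. $a\vee b=\max(a,b)$; integrals are over $[0,1]^d$. For nonnegative sequences, $a_n\lesssim b_n$ means there is a constant $C>0$ with $a_n\le Cb_n$ for all $n\ge n_0$; $a_n\gtrsim b_n$ means $b_n\lesssim a_n$; $a_n\asymp b_n$ means both. The resolution $k$ is a sequence that may depend on $n$. Wavelets. Fix a compactly supported Cohen–Daubechies–Vial type orthonormal wavelet basis $\{\Phi_{J_0m},\Psi^{\iota}_{lm'}: m\in\mathcal Z_{J_0},\,m'\in\mathcal Z_l,\,\iota\in\{0,1\}^d\setminus\{0\},\,l\ge J_0\}$ of $L^2([0,1]^d)$ of regularity $S\ge1$, $S>\alpha\vee\beta$, with $2^{J_0}\ge S$, $|\mathcal Z_l|\asymp 2^{ld}$. For $j\ge J_0$ let $V_j=\mathrm{span}\{\Phi_{jm}:m\in\mathcal Z_j\}$ ($\{\Phi_{jm}\}_m$ the orthonormal scaling functions at level $j$; the $V_j$ are nested). A resolution is a number $k=2^{jd}$,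 $j\ge J_0$ (so prescribed values such as $c\,n^a$ are understood up to bounded constant factors); write $V_k,\Phi_{km},\mathcal Z_k$ for $V_j,\Phi_{jm},\mathcal Z_j$. Standard properties: $|\Phi_{km}|\lesssim\sqrt k$ uniformly with support in a set of Lebesgue measure $O(1/k)$; $V_k$ contains all polynomials of degree at most $S-1$. The projection kernel is $K_{V_k}(x,y)=\sum_{m\in\mathcal Z_k}\Phi_{km}(x)\Phi_{km}(y)$. Hölder ball. $H(\alpha,M)$ is the set of uniformly continuous $h:[0,1]^d\to\mathbb R$ with $2^{J_0(\alpha+d/2)}\max_m|\langle h,\Phi_{J_0m}\rangle|+\sup_{l\ge J_0,m\in\mathcal Z_l,\iota}2^{l(\alpha+d/2)}|\langle h,\Psi^\iota_{lm}\rangle|\le M$. Model. $\mathcal P_{(\alpha,\beta)}$ is the set of distributions $\mathbb P$ of $(X,A,Y)\in[0,1]^d\times\mathbb R\times\mathbb R$ with $X\sim\mathrm{Uniform}([0,1]^d)$, $A,Y\in[C_1,C_2]$ a.s., $p(x):=\mathbb E_{\mathbb P}[A\mid X=x]\in H(\alpha,M)$ and $b(x):=\mathbb E_{\mathbb P}[Y\mid X=x]\in H(\beta,M)$, where $C_1,C_2\in\mathbb R$, $\alpha,\beta,M>0$ are fixed known constants. The functional is $\psi(\mathbb P)=\mathbb E_{\mathbb P}[\mathrm{Cov}_{\mathbb P}(A,Y\mid X)]$. Estimator. I.i.d. observations from $\mathbb P$ are split into two disjoint subsamples $\mathcal D_1,\mathcal D_2$, each of size $n$. Put $\hat b^{(1)}_k(x)=\frac1n\sum_{i\in\mathcal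 D_1}Y_iK_{V_k}(X_i,x)$ and $\hat\psi^{\mathrm{NR}}_k=\frac1n\sum_{i\in\mathcal D_2}A_i(Y_i-\hat b^{(1)}_k(X_i))$. Rates. The (known) minimax rate for squared error over $\mathcal P_{(\alpha,\beta)}$ is $r_n^*=n^{-1}$ if $\frac{\alpha+\beta}2\ge\frac d4$ and $r_n^*=n^{-\frac{4\alpha+4\beta}{2\alpha+2\beta+d}}$ if $\frac{\alpha+\beta}2<\frac d4$. The estimator is minimax rate optimal for a choice of $k$ if $\sup_{\mathbb P\in\mathcal P_{(\alpha,\beta)}}\mathbb E_{\mathbb P}[(\hat\psi^{\mathrm{NR}}_k-\psi(\mathbb P))^2]\lesssim r_n^*$.
   Formalization: The formal theorem also assumes C_1<C_2 and that the class is already nonempty for some radius M'<M; without these the ''only if'' can fail (e.g. C_1=C_2, or an empty class, where the estimator is always rate optimal). *)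

(* Defs.v *)
From HB Require Import structures.
From mathcomp Require Import all_boot all_order all_algebra.
From mathcomp Require Import all_classical all_reals all_analysis.

Set Implicit Arguments.
Unset Strict Implicit.
Unset Printing Implicit Defensive.
Import Order.TTheory GRing.Theory Num.Theory.
Import numFieldNormedType.Exports.

Local Open Scope classical_set_scope.
Local Open Scope ring_scope.

(* * Independent sampling *)

Section iid.
Context {dT : measure_display} {T : measurableType dT} {R : realType}.

Definition tcons n (z : T * n.-tuple T) : n.+1.-tuple T := [tuple of z.1 :: z.2].

Lemma measurable_tcons n : measurable_fun [set: T * n.-tuple T] (@tcons n).
Proof. exact: measurable_cons. Qed.

HB.instance Definition _ n :=
  isMeasurableFun.Build _ _ _ _ (@tcons n) (@measurable_tcons n).

(* The n-fold product P x ... x P, i.e. the law of n i.i.d. draws from P. *)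
Fixpoint iid (P : probability T R) (n : nat) : probability (n.-tuple T) R :=
  if n is m.+1 then distribution (P \x iid P m)%E (@tcons m)
  else dirac [tuple].

End iid.

(* * Conditional expectation given X *)

Section cond_exp.
Context {d1 d2 : measure_display} {T : measurableType d1}
  {E : measurableType d2} {R : realType}.
Variables (P : probability T R) (X : T -> E).

(* f is a version of x |-> E[W | X = x]. *)
Definition is_cond_exp (W : T -> R) (f : E -> R) : Prop :=
  [/\ measurable_fun [set: E] f,
      P.-integrable [set: T] (EFin \o (f \o X)) &
      forall B : set E, measurable B ->
        (\int[P]_(w in X @^-1` B) (f (X w))%:E =
         \int[P]_(w in X @^-1` B) (W w)%:E)%E].

(* A chosen version; the choice is irrelevant up to null sets of the law of X. *)
Definition cond_exp (W : T -> R) : E -> R := xget (fun=> 0) (is_cond_exp W).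

Definition cond_cov (U V : T -> R) : E -> R :=
  cond_exp (fun w => (U w - cond_exp U (X w)) * (V w - cond_exp V (X w))).

End cond_exp.

(* * Wavelets *)

Section wavelets_1d.
Variable R : realType.

Definition inner01 (f g : R -> R) : R :=
  \int[lebesgue_measure]_(t in `[0, 1]) (f t * g t).

(* Equality on [0, 1] with a linear combination of the functions e m. *)
Definition in_span01 (I : finType) (e : I -> R -> R) (f : R -> R) : Prop :=
  exists c : I -> R, forall t, 0 <= t <= 1 -> f t = \sum_m c m * e m t.

(* Compactly supported, boundary-adapted (Cohen-Daubechies-Vial type)
   orthonormal multiresolution analysis of L^2([0, 1]) of regularity S, from
   level J0 on, with 2 ^ j scaling functions and 2 ^ j wavelets at level j.
   Regularity S enters as continuity of the functions together with
   reproduction of the polynomials of degree at most S - 1.  Only the values on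
   [0, 1] matter: a boundary function is extended to R in any continuous and
   compactly supported way. *)
Record cdv_basis (S J0 : nat) := CDVBasis {
  scaling : forall j, 'I_(2 ^ j) -> R -> R;
  wavelet : forall j, 'I_(2 ^ j) -> R -> R;
  (* All functions are dyadic dilations and integer translations of finitely
     many shapes: the interior ones, and the boundary ones attached to 0 and
     to 1. *)
  cdv_dyadic : exists (N : nat) (g : 'I_N -> R -> R),
    [/\ forall s, continuous (g s),
        forall s, exists B : R, forall t, B < `|t| -> g s t = 0,
        forall j (m : 'I_(2 ^ j)), (J0 <= j)%N -> exists s, forall t,
          scaling m t = Num.sqrt (2 ^+ j) * g s (2 ^+ j * t - m%:R) &
        forall j (m : 'I_(2 ^ j)), (J0 <= j)%N -> exists s, forall t,
          wavelet m t = Num.sqrt (2 ^+ j) * g s (2 ^+ j * t - m%:R)];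
  cdv_scaling_on : forall j (m m' : 'I_(2 ^ j)), (J0 <= j)%N ->
    inner01 (scaling m) (scaling m') = (m == m')%:R;
  cdv_wavelet_on : forall j l (m : 'I_(2 ^ j)) (m' : 'I_(2 ^ l)),
    (J0 <= j)%N -> (J0 <= l)%N ->
    inner01 (wavelet m) (wavelet m') = ((j == l) && (m == m' :> nat))%:R;
  cdv_scaling_wavelet : forall j (m m' : 'I_(2 ^ j)), (J0 <= j)%N ->
    inner01 (scaling m) (wavelet m') = 0;
  (* V_(j+1) is the sum of V_j and W_j. *)
  cdv_scaling_up : forall j (m : 'I_(2 ^ j)), (J0 <= j)%N ->
    in_span01 (@scaling j.+1) (scaling m);
  cdv_wavelet_up : forall j (m : 'I_(2 ^ j)), (J0 <= j)%N ->
    in_span01 (@scaling j.+1) (wavelet m);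
  cdv_scaling_down : forall j (m : 'I_(2 ^ j.+1)), (J0 <= j)%N ->
    in_span01 (fun i : 'I_(2 ^ j) + 'I_(2 ^ j) =>
      match i with inl a => scaling a | inr b => wavelet b end) (scaling m);
  cdv_dense : forall f : R -> R, measurable_fun (`[0, 1] : set R) f ->
    lebesgue_measure.-integrable `[0, 1] (EFin \o (fun t => f t ^+ 2)) ->
    forall e : R, 0 < e ->
    exists (j : nat) (c : 'I_(2 ^ j) -> R), (J0 <= j)%N /\
      inner01 (fun t => f t - \sum_m c m * scaling m t)
              (fun t => f t - \sum_m c m * scaling m t) < e;
  cdv_poly : forall j (q : {poly R}), (J0 <= j)%N -> (size q <= S)%N ->
    in_span01 (@scaling j) (fun t => q.[t])
}.

End wavelets_1d.

Section wavelets.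
Variables (R : realType) (d : nat).

Definition point := d.-tuple (measurableTypeR R).

Definition cube : set point := [set x | forall i, 0 <= tnth x i <= 1].

(* The uniform distribution on the cube, i.e. Lebesgue measure on it. *)
Definition unif_cube : probability point R := iid (uniform_prob (@ltr01 R)) d.

Definition inner (f g : point -> R) : R :=
  \int[unif_cube]_(x in cube) (f x * g x).

Variables (S J0 : nat) (W : cdv_basis R S J0).

(* The index set Z_l of cardinality 2 ^ (l d). *)
Definition loc (l : nat) := {ffun 'I_d -> 'I_(2 ^ l)}.

Definition Phi j (m : loc j) (x : point) : R :=
  \prod_(i < d) scaling W (m i) (tnth x i).

Definition Psi l (iota : {ffun 'I_d -> bool}) (m : loc l) (x : point) : R :=
  \prod_(i < d) (if iota i then wavelet W (m i) (tnth x i)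
                 else scaling W (m i) (tnth x i)).

Definition projK j (x y : point) : R := \sum_(m : loc j) Phi m x * Phi m y.

Definition unif_continuous_cube (h : point -> R) : Prop :=
  forall e : R, 0 < e -> exists2 r : R, 0 < r &
    forall x y, cube x -> cube y ->
      (forall i, `|tnth x i - tnth y i| < r) -> `|h x - h y| < e.

Definition coarse_norm (a : R) (h : point -> R) : R :=
  2 `^ (J0%:R * (a + d%:R / 2)) *
  \big[Num.max/0]_(m : loc J0) `|inner h (Phi m)|.

Definition detail_norm (a : R) (h : point -> R) : \bar R :=
  ereal_sup [set v | exists l (iota : {ffun 'I_d -> bool}) (m : loc l),
    [/\ (J0 <= l)%N, iota != [ffun=> false] &
        v = (2 `^ (l%:R * (a + d%:R / 2)) * `|inner h (Psi iota m)|)%:E]].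

Definition holder_ball (a M : R) : set (point -> R) :=
  [set h | unif_continuous_cube h /\
           ((coarse_norm a h)%:E + detail_norm a h <= M%:E)%E].

End wavelets.

(* * Model, functional and estimator *)

Section model.
Variables (R : realType) (d : nat).

Definition obs := (point R d * measurableTypeR R * measurableTypeR R)%type.
Definition obsX (z : obs) : point R d := z.1.1.
Definition obsA (z : obs) : R := z.1.2.
Definition obsY (z : obs) : R := z.2.

Definition psi (P : probability obs R) : R :=
  \int[P]_z cond_cov P obsX obsA obsY (obsX z).

Variables (S J0 : nat) (W : cdv_basis R S J0).

Definition model (C1 C2 alpha beta M : R) : set (probability obs R) :=
  [set P : probability obs R |
    [/\ forall B, measurable B -> P (obsX @^-1` B) = unif_cube R d B,
        {ae P, forall z, C1 <= obsA z <= C2},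
        {ae P, forall z, C1 <= obsY z <= C2},
        exists p, is_cond_exp P obsX obsA p /\ holder_ball W alpha M p &
        exists b, is_cond_exp P obsX obsY b /\ holder_ball W beta M b]].

Definition bhat j n (D1 : n.-tuple obs) (x : point R d) : R :=
  n%:R^-1 * \sum_(i < n) obsY (tnth D1 i) * projK W j (obsX (tnth D1 i)) x.

Definition psi_NR j n (D1 D2 : n.-tuple obs) : R :=
  n%:R^-1 * \sum_(i < n) obsA (tnth D2 i) *
    (obsY (tnth D2 i) - bhat j D1 (obsX (tnth D2 i))).

Definition mse j n (P : probability obs R) : \bar R :=
  (\int[iid P n \x iid P n]_D ((psi_NR j D.1 D.2 - psi P) ^+ 2)%:E)%E.

(* a_n <= C b_n for all large n. *)
Definition lesssim (a b : nat -> \bar R) : Prop :=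
  exists2 C : R, 0 < C & \forall n \near \oo, (a n <= C%:E * b n)%E.

Definition asymp (a b : nat -> \bar R) : Prop := lesssim a b /\ lesssim b a.

Definition rate (alpha beta : R) (n : nat) : R :=
  if d%:R / 4 <= (alpha + beta) / 2 then n%:R^-1
  else n%:R `^ (- ((4 * alpha + 4 * beta) / (2 * alpha + 2 * beta + d%:R))).

(* j n is the level of the resolution k = 2 ^ (j n * d) used at sample size n. *)
Definition minimax_rate_optimal (C1 C2 alpha beta M : R) (j : nat -> nat) :=
  lesssim
    (fun n => ereal_sup [set mse (j n) n P | P in model C1 C2 alpha beta M])
    (fun n => (rate alpha beta n)%:E).

End model.

(* Main.v *)
Require Import Defs.
From HB Require Import structures.
From mathcomp Require Import all_boot all_order all_algebra.
From mathcomp Require Import all_classical all_reals all_analysis.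
From mathcomp Require Import measurable_realfun zify ring lra.
Import Order.TTheory GRing.Theory Num.Theory.
Import numFieldNormedType.Exports.
Set Implicit Arguments.
Unset Strict Implicit.
Unset Printing Implicit Defensive.
Local Open Scope classical_set_scope.
Local Open Scope ring_scope.

(** Write p and b for the conditional means of A and Y, Pi_j for the orthogonal
    projection onto V_j and k = 2^(jd) for its dimension.  Given the first
    subsample the estimator is an average of n i.i.d. terms, and its conditional
    mean is again, up to a constant, an average of n i.i.d. terms over the first
    subsample.  Using twice the second moment formula for averages of i.i.d.
    terms shows that the mean squared error is the squared bias plus a variance
    of order at most 1/n + k/n^2 ([split_mse_ge_bias], [split_mse_le]).  Since
    psi(P) = E[AY] - E[p b] ([expect_cond_cov]), the bias is the residual form
    <p, b> - <Pi_j p, Pi_j b> = <p, b - Pi_j b>.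

    Expanding the residual form in the wavelets of the levels l >= j, the at
    most 2^d 2^(ld) coefficient products of level l, each at most
    M^2 2^(-l(alpha + beta + d)), sum to a geometric series in
    2^(-l(alpha + beta)), so the bias is O(2^(-j(alpha + beta))), that is,
    O(k^(-(alpha + beta)/d)) ([resid_form_le]).  This order is attained:
    adding to p and b suitable multiples of the sum g of the 2^(jd) wavelets of
    level j without scaling function factors keeps both in their balls, and the
    residual form takes the value 2^(jd) at (g, g).  The interaction with the unperturbed p and b is removed by
    polarization over the four choices of signs ([mse_lower_bound]).

    At k of order n^(d/(2 beta + d)) the variance is O(1/n) and the worst
    squared bias is of exact order n^(-x) with
    x = 2(alpha + beta)/(2 beta + d).  If alpha >= d/2 then x >= 1 and the
    minimax rate is 1/n, so the estimator is optimal.  If alpha < d/2 then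
    x < 1, and also x < 4(alpha + beta)/(2 alpha + 2 beta + d), the latter
    being equivalent to 2 alpha < 2 beta + d; hence x is smaller than the
    exponent of the minimax rate in both of its regimes. *)

(** * Essentially bounded functions *)

Section ess_bounded.
Context {d : measure_display} {T : measurableType d} {R : realType}.
Variable mu : probability T R.
Implicit Types f g : T -> R.

(** Observations are bounded only almost surely, and functions on the cube only
    on the cube.  Essentially bounded functions form an algebra on which the
    expectation is finite and linear, which disposes of integrability. *)
Definition ess_bdd f : Prop := measurable_fun [set: T] f /\
  exists B : R, {ae mu, forall x, `|f x| <= B}.

Lemma ae_bounded_ess_bdd f B : measurable_fun [set: T] f ->
  {ae mu, forall x, `|f x| <= B} -> ess_bdd f.
Proof. by move=> mf fB; split => //; exists B. Qed.

Lemma ess_bdd_mfun f : ess_bdd f -> measurable_fun [set: T] f.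
Proof. by case. Qed.

Lemma bounded_ess_bdd f B : measurable_fun [set: T] f ->
  (forall x, `|f x| <= B) -> ess_bdd f.
Proof. by move=> mf fB; apply: (ae_bounded_ess_bdd (B := B)) => //; exact: aeW. Qed.

Lemma ess_bdd_cst c : ess_bdd (fun=> c).
Proof. exact: (@bounded_ess_bdd _ `|c|). Qed.

Lemma ess_bddD f g : ess_bdd f -> ess_bdd g -> ess_bdd (fun x => f x + g x).
Proof.
move=> [mf [B fB]] [mg [C gC]]; split; first exact: measurable_funD.
exists (B + C); near=> x; rewrite (le_trans (ler_normD _ _))// lerD//.
  by near: x; exact: fB.
by near: x; exact: gC.
Unshelve. all: by end_near. Qed.

Lemma ess_bddM f g : ess_bdd f -> ess_bdd g -> ess_bdd (fun x => f x * g x).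
Proof.
move=> [mf [B fB]] [mg [C gC]]; split; first exact: measurable_funM.
exists (B * C); near=> x; rewrite normrM ler_pM//.
  by near: x; exact: fB.
by near: x; exact: gC.
Unshelve. all: by end_near. Qed.

Lemma ess_bddZ c f : ess_bdd f -> ess_bdd (fun x => c * f x).
Proof. by move=> bf; apply: ess_bddM => //; exact: ess_bdd_cst. Qed.

Lemma ess_bddN f : ess_bdd f -> ess_bdd (fun x => - f x).
Proof.
move=> bf; under eq_fun do rewrite -mulN1r; exact: ess_bddZ.
Qed.

Lemma ess_bddB f g : ess_bdd f -> ess_bdd g -> ess_bdd (fun x => f x - g x).
Proof. by move=> bf bg; apply: ess_bddD => //; exact: ess_bddN. Qed.

Lemma ess_bddX f n : ess_bdd f -> ess_bdd (fun x => f x ^+ n).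
Proof.
move=> bf; elim: n => [|n IH]; first exact: ess_bdd_cst.
by under eq_fun do rewrite exprS; exact: ess_bddM.
Qed.

Lemma ess_bdd_sum (I : Type) (s : seq I) (F : I -> T -> R) :
  (forall i, ess_bdd (F i)) -> ess_bdd (fun x => \sum_(i <- s) F i x).
Proof.
move=> bF; elim: s => [|i s IH].
  by under eq_fun do rewrite big_nil; exact: ess_bdd_cst.
by under eq_fun do rewrite big_cons; exact: ess_bddD.
Qed.

Lemma ess_bdd_int f : ess_bdd f -> mu.-integrable [set: T] (EFin \o f).
Proof.
move=> [mf [B fB]]; apply/integrableP; split; first exact/measurable_EFinP.
apply: (@le_lt_trans _ _ (\int[mu]_x `|B|%:E)%E); last first.
  by rewrite integral_cst//= [X in (_ * X)%E]probability_setT mule1 ltry.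
apply: ae_ge0_le_integral => //.
- by apply: measurableT_comp => //; exact/measurable_EFinP.
- near=> x => _ /=; rewrite lee_fin (le_trans _ (ler_norm B))//.
  by near: x; exact: fB.
Unshelve. all: by end_near. Qed.

Lemma expect_EFin f : ess_bdd f ->
  (\int[mu]_x (f x)%:E)%E = (\int[mu]_x f x)%:E.
Proof.
by move=> /ess_bdd_int bf; rewrite /Rintegral fineK//; apply: integrable_fin_num.
Qed.

Lemma expectD f g : ess_bdd f -> ess_bdd g ->
  \int[mu]_x (f x + g x) = \int[mu]_x f x + \int[mu]_x g x.
Proof. by move=> bf bg; rewrite RintegralD//; exact: ess_bdd_int. Qed.

Lemma expectB f g : ess_bdd f -> ess_bdd g ->
  \int[mu]_x (f x - g x) = \int[mu]_x f x - \int[mu]_x g x.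
Proof. by move=> bf bg; rewrite RintegralB//; exact: ess_bdd_int. Qed.

Lemma expectZ c f : ess_bdd f -> \int[mu]_x (c * f x) = c * \int[mu]_x f x.
Proof. by move=> bf; rewrite RintegralZl//; exact: ess_bdd_int. Qed.

Lemma expect_cst c : \int[mu]_x (c : R) = c.
Proof. by rewrite Rintegral_cst//= [X in fine X]probability_setT mulr1. Qed.

Lemma expect_sum (I : Type) (s : seq I) (F : I -> T -> R) :
  (forall i, ess_bdd (F i)) ->
  \int[mu]_x (\sum_(i <- s) F i x) = \sum_(i <- s) \int[mu]_x F i x.
Proof.
move=> bF; elim: s => [|i s IH].
  by rewrite big_nil; under eq_Rintegral do rewrite big_nil; rewrite expect_cst.
rewrite big_cons -IH -expectD//; last exact: ess_bdd_sum.
by under eq_Rintegral do rewrite big_cons.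
Qed.

Lemma expect_ae_eq f g : measurable_fun [set: T] f ->
  measurable_fun [set: T] g -> {ae mu, forall x, f x = g x} ->
  \int[mu]_x f x = \int[mu]_x g x.
Proof.
move=> mf mg fg; congr fine; apply: ae_eq_integral => //.
- exact/measurable_EFinP.
- exact/measurable_EFinP.
- by apply: filterS fg => x -> .
Qed.

Lemma expect_ae_ge0 f : ess_bdd f -> {ae mu, forall x, 0 <= f x} ->
  0 <= \int[mu]_x f x.
Proof.
move=> bf f0; rewrite (@expect_ae_eq _ (fun x => `|f x|)).
- by apply: Rintegral_ge0.
- exact: ess_bdd_mfun.
- by apply: measurableT_comp => //; exact: ess_bdd_mfun.
- by apply: filterS f0 => x /ger0_norm ->.
Qed.

Lemma expect_ae_le f g : ess_bdd f -> ess_bdd g ->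
  {ae mu, forall x, f x <= g x} -> \int[mu]_x f x <= \int[mu]_x g x.
Proof.
move=> bf bg fg; rewrite -subr_ge0 -expectB//; apply: expect_ae_ge0.
  exact: ess_bddB.
by apply: filterS fg => x; rewrite subr_ge0.
Qed.

Lemma ess_bdd_ae_eq f g : ess_bdd f -> measurable_fun [set: T] g ->
  {ae mu, forall x, f x = g x} -> ess_bdd g.
Proof.
move=> [mf [B fB]] mg fg; split => //; exists B.
by apply: filterS2 fB fg => x + <-.
Qed.

Lemma expect_CS f g : ess_bdd f -> ess_bdd g ->
  (\int[mu]_x (f x * g x)) ^+ 2 <=
  (\int[mu]_x (f x ^+ 2)) * \int[mu]_x (g x ^+ 2).
Proof.
move=> bf bg.
set a := \int[mu]_x (f x ^+ 2); set b := \int[mu]_x (g x ^+ 2).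
set c := \int[mu]_x (f x * g x).
(* The quadratic form (u, v) |-> E[(u f - v g)^2] is nonnegative. *)
have H u v : 0 <= u ^+ 2 * a - 2 * u * v * c + v ^+ 2 * b.
  have -> : u ^+ 2 * a - 2 * u * v * c + v ^+ 2 * b
      = \int[mu]_x ((u * f x - v * g x) ^+ 2).
    rewrite -!expectZ; [|by repeat first [exact: ess_bddX|exact: ess_bddM]..].
    rewrite -expectB; [|by apply: ess_bddZ; first [exact: ess_bddX|exact: ess_bddM]..].
    rewrite -expectD; last 2 first.
    - by apply: ess_bddB; apply: ess_bddZ; first [exact: ess_bddX|exact: ess_bddM].
    - by apply: ess_bddZ; exact: ess_bddX.
    by apply: eq_Rintegral => x _; ring.
  by apply: Rintegral_ge0 => x _; exact: sqr_ge0.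
have a0 : 0 <= a by apply: Rintegral_ge0 => x _; exact: sqr_ge0.
have := H c a.
have [a_eq0 _|aN0 h] := eqVneq a 0.
  have := H (b + 1) c; rewrite a_eq0 => h.
  rewrite mul0r; have : b >= 0 by apply: Rintegral_ge0 => x _; exact: sqr_ge0.
  move=> b0; have := sqr_ge0 c; nra.
have ap : 0 < a by rewrite lt_neqAle eq_sym aN0.
rewrite -subr_ge0 -(pmulr_rge0 _ ap); move: h; congr (_ <= _); ring.
Qed.

End ess_bounded.

(** * Change of variables *)

Section law.
Context {d d' : measure_display} {T : measurableType d} {E : measurableType d'}
  {R : realType}.
Variables (P : probability T R) (nu : probability E R) (X : T -> E).
Hypothesis mX : measurable_fun [set: T] X.

Definition has_law := forall B, measurable B -> P (X @^-1` B) = nu B.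

Hypothesis XP : has_law.

Lemma measurable_preimage B : measurable B -> measurable (X @^-1` B).
Proof. by move=> mB; rewrite -[X in measurable X]setTI; exact: mX. Qed.

Lemma law_ae (Q : E -> Prop) : {ae nu, forall x, Q x} ->
  {ae P, forall w, Q (X w)}.
Proof.
move=> [N [mN N0 NQ]]; exists (X @^-1` N); split.
- exact: measurable_preimage.
- by rewrite XP.
- by move=> w Qw; apply: NQ.
Qed.

Lemma law_ae_inv (Q : E -> Prop) : measurable [set x | Q x] ->
  {ae P, forall w, Q (X w)} -> {ae nu, forall x, Q x}.
Proof.
move=> mQ [N [mN N0 NQ]]; exists (~` [set x | Q x]); split => //.
  exact: measurableC.
rewrite -XP; last exact: measurableC.
apply/eqP; rewrite -measure_le0 -N0 le_measure ?inE//.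
by apply: measurable_preimage; exact: measurableC.
Qed.

Lemma law_ess_bdd f : ess_bdd nu f -> ess_bdd P (f \o X).
Proof.
move=> [mf [B fB]]; split; first exact: measurableT_comp.
by exists B; exact: (law_ae fB).
Qed.

Lemma law_ge0_integral (f : E -> \bar R) : measurable_fun [set: E] f ->
  (forall x, 0 <= f x)%E -> (\int[nu]_x f x = \int[P]_w f (X w))%E.
Proof.
move=> mf f0.
rewrite -[RHS](@ge0_integral_pushforward _ _ _ _ _ X mX P setT f)//.
by apply: eq_measure_integral => B mB _; have /esym := XP mB.
Qed.

Lemma law_integral B (f : E -> \bar R) : measurable B ->
  measurable_fun [set: E] f -> P.-integrable [set: T] (f \o X) ->
  (\int[nu]_(x in B) f x = \int[P]_(w in X @^-1` B) f (X w))%E.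
Proof.
move=> mB mf intf.
rewrite -[RHS](@integral_pushforward _ _ _ _ _ X mX P B f)//; last first.
  by apply: integrableS intf => //; exact: measurable_preimage.
by apply: eq_measure_integral => C mC _; have /esym := XP mC.
Qed.

Lemma law_integrable (f : E -> \bar R) :
  measurable_fun [set: E] f -> P.-integrable [set: T] (f \o X) ->
  nu.-integrable [set: E] f.
Proof.
move=> mf /integrableP[_ h]; apply/integrableP; split => //.
rewrite law_ge0_integral//; exact: measurableT_comp.
Qed.

Lemma law_expect f : measurable_fun [set: E] f ->
  ess_bdd P (f \o X) -> \int[nu]_x f x = \int[P]_w f (X w).
Proof.
move=> mf bf; congr fine; rewrite (@law_integral setT)//.
- exact/measurable_EFinP.
- exact: (ess_bdd_int bf).
Qed.

End law.

(** * Integrals over i.i.d. samples *)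

Section iid_integrals.
Context {d : measure_display} {T : measurableType d} {R : realType}.
Variable P : probability T R.

(** Variance plus squared bias.  Integrating out one draw only moves the
    constant c, so the induction runs over all c. *)
Lemma iid_sum_second_moment (h : T -> R) n c : ess_bdd P h ->
  (\int[iid P n]_t ((\sum_(i < n) h (tnth t i) - c) ^+ 2)%:E)%E =
  (n%:R * (\int[P]_x (h x ^+ 2) - (\int[P]_x h x) ^+ 2) +
   (n%:R * \int[P]_x h x - c) ^+ 2)%:E.
Proof.
move=> bh; have [mh _] := bh.
set s := \int[P]_x (h x ^+ 2); set mu := \int[P]_x h x.
have msum k (c' : R) : measurable_fun setT
    (fun t : k.-tuple T => (\sum_(i < k) h (tnth t i) - c') ^+ 2).
  apply: measurable_funX; apply: measurable_funB => //.
  apply: measurable_sum => i; apply: measurableT_comp => //.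
  exact: measurable_tnth.
elim: n c => [|n IH] c.
  rewrite /= integral_dirac//; last first.
    by have /measurable_EFinP := msum 0%N c.
  by rewrite diracE in_setT mul1e big_ord0; congr EFin; ring.
rewrite /= ge0_integral_distribution; last 2 first.
- by have /measurable_EFinP := msum n.+1 c.
- by move=> t; rewrite lee_fin sqr_ge0.
pose F (z : T * n.-tuple T) :=
  ((\sum_(i < n) h (tnth z.2 i) - (c - h z.1)) ^+ 2)%:E.
rewrite (eq_integral F); last first.
  move=> [x t] _; rewrite /F/= big_ord_recl; congr (_ ^+ 2)%:E.
  rewrite (tnth_nth x)/= opprB addrCA addrA; congr (_ + _ - _).
  by apply: eq_bigr => i _; rewrite !(tnth_nth x).
have mF : measurable_fun setT F.
  apply/measurable_EFinP; apply: measurable_funX; apply: measurable_funB.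
    apply: measurable_sum => i; apply: measurableT_comp => //.
    by apply: (measurableT_comp (measurable_tnth i)); exact: measurable_snd.
  by apply: measurable_funB => //; apply: measurableT_comp => //; exact: measurable_fst.
rewrite fubini_tonelli1//; last by move=> z; rewrite lee_fin sqr_ge0.
rewrite /fubini_F /F /=; under eq_integral do rewrite IH.
have bq : ess_bdd P (fun x => h x ^+ 2) by exact: ess_bddX.
have bl : ess_bdd P (fun x => 2 * (n%:R * mu - c) * h x) by exact: ess_bddZ.
have -> : (\int[P]_x (n%:R * (s - mu ^+ 2) + (n%:R * mu - (c - h x)) ^+ 2)%:E)%E
  = (\int[P]_x (h x ^+ 2 + 2 * (n%:R * mu - c) * h x +
       (n%:R * (s - mu ^+ 2) + (n%:R * mu - c) ^+ 2))%:E)%E.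
  by apply: eq_integral => x _; congr EFin; ring.
rewrite (expect_EFin (f := fun x => _)); last first.
  by apply: ess_bddD; [exact: ess_bddD|exact: ess_bdd_cst].
rewrite expectD//; [|exact: ess_bddD|exact: ess_bdd_cst].
rewrite expectD// expectZ// expect_cst -/s -/mu; congr EFin.
by rewrite -[n.+1%:R]natr1; ring.
Qed.

Lemma iid_avg_second_moment (h : T -> R) n c : (0 < n)%N -> ess_bdd P h ->
  (\int[iid P n]_t ((n%:R^-1 * (\sum_(i < n) h (tnth t i)) - c) ^+ 2)%:E)%E =
  (n%:R^-1 * (\int[P]_x (h x ^+ 2) - (\int[P]_x h x) ^+ 2) +
   (\int[P]_x h x - c) ^+ 2)%:E.
Proof.
move=> n0 bh; have n0' : n%:R != 0 :> R by rewrite pnatr_eq0 -lt0n.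
transitivity (\int[iid P n]_t ((n%:R ^- 2)%:E *
    ((\sum_(i < n) h (tnth t i) - n%:R * c) ^+ 2)%:E))%E.
  by apply: eq_integral => t _; rewrite -EFinM; congr EFin; field.
rewrite ge0_integralZl//.
- by rewrite iid_sum_second_moment// -EFinM; congr EFin; field.
- apply/measurable_EFinP; apply: measurable_funX; apply: measurable_funB => //.
  apply: measurable_sum => i; apply: measurableT_comp => //; first by case: bh.
  exact: measurable_tnth.
- by move=> t _; rewrite lee_fin sqr_ge0.
Qed.

(** Independence of the coordinates; with the uniform law on [0, 1] this
    reduces inner products of tensor-product wavelets to one dimension. *)
Lemma iid_expect_prod n (h : 'I_n -> T -> R) :
  (forall i, measurable_fun [set: T] (h i)) ->
  (forall i, exists B : R, forall x, `|h i x| <= B) ->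
  \int[iid P n]_t (\prod_(i < n) h i (tnth t i)) =
  \prod_(i < n) \int[P]_x h i x.
Proof.
move=> mh bh; rewrite /Rintegral; suff H : forall n (h : 'I_n -> T -> R),
  (forall i, measurable_fun [set: T] (h i)) ->
  (forall i, exists B : R, forall x, `|h i x| <= B) ->
  (\int[iid P n]_t (\prod_(i < n) h i (tnth t i))%:E)%E =
    (\prod_(i < n) \int[P]_x h i x)%:E by rewrite (H n h mh bh).
move=> {mh bh h n}; elim=> [h _ _|n IH h mh bh].
  rewrite /= integral_dirac//; last first.
    by apply/measurable_EFinP; apply: measurable_prod => -[].
  by rewrite diracE in_setT mul1e !big_ord0.
have [B hB] : exists B : 'I_n.+1 -> R, forall i x, `|h i x| <= B i.
  by have [B hB] := choice bh; exists B.
have mprod k (h' : 'I_k -> T -> R) : (forall i, measurable_fun [set: T] (h' i)) ->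
    measurable_fun setT (fun t : k.-tuple T => \prod_(i < k) h' i (tnth t i)).
  move=> mh'; apply: measurable_prod => i _; apply: measurableT_comp => //.
  exact: measurable_tnth.
have bprod (t : n.+1.-tuple T) : `|\prod_(i < n.+1) h i (tnth t i)| <= \prod_i B i.
  by rewrite normr_prod; apply: ler_prod => i _; rewrite normr_ge0 hB.
have mcons : measurable_fun setT
    (fun z : T * n.-tuple T => \prod_(i < n.+1) h i (tnth (tcons z) i)).
  exact: (measurableT_comp (mprod _ h mh) (measurable_tcons (n := n))).
rewrite /= integral_distribution; last 2 first.
- by apply/measurable_EFinP; exact: mprod.
- apply: (@ess_bdd_int _ _ _ (P \x iid P n)%E
    (fun z => \prod_(i < n.+1) h i (tnth (tcons z) i))).
  exact: (@bounded_ess_bdd _ _ _ _ _ (\prod_i B i)).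
pose F (z : T * n.-tuple T) :=
  (h ord0 z.1 * \prod_(i < n) h (lift ord0 i) (tnth z.2 i))%:E.
have FE z : (\prod_(i < n.+1) h i (tnth (tcons z) i))%:E = F z.
  rewrite /F big_ord_recl (tnth_nth z.1)/=; congr (_ * _)%:E.
  by apply: eq_bigr => i _; rewrite !(tnth_nth z.1).
rewrite (eq_integral F); last by move=> z _; exact: FE.
rewrite -integral12_prod_meas1; last first.
  have -> : F = EFin \o (fun z => \prod_(i < n.+1) h i (tnth (tcons z) i)).
    by apply/funext => z /=; rewrite FE.
  apply: ess_bdd_int; exact: (@bounded_ess_bdd _ _ _ _ _ (\prod_i B i)).
rewrite /fubini_F /F /=.
have bl : ess_bdd (iid P n)
    (fun t => \prod_(i < n) h (lift ord0 i) (tnth t i)).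
  apply: (@bounded_ess_bdd _ _ _ _ _ (\prod_i B (lift ord0 i))).
    exact: (mprod _ (fun i => h (lift ord0 i))).
  by move=> t; rewrite normr_prod; apply: ler_prod => i _; rewrite normr_ge0 hB.
have IH' : \int[iid P n]_t (\prod_(i < n) h (lift ord0 i) (tnth t i)) =
    \prod_(i < n) \int[P]_x h (lift ord0 i) x.
  by rewrite /Rintegral (IH (fun i => h (lift ord0 i))).
under eq_integral => x _.
  rewrite (expect_EFin (f := fun t => h ord0 x * _)); last exact: ess_bddZ.
  rewrite expectZ// IH' mulrC.
  over.
rewrite (expect_EFin (f := fun x => _ * h ord0 x)); last first.
  by apply/ess_bddZ/bounded_ess_bdd; [exact: mh|exact: hB].
rewrite expectZ; last by apply: bounded_ess_bdd; [exact: mh|exact: hB].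
by rewrite big_ord_recl mulrC.
Qed.

End iid_integrals.

Lemma variance_ge0 {d : measure_display} {T : measurableType d} {R : realType}
    (P : probability T R) (h : T -> R) : ess_bdd P h ->
  0 <= \int[P]_x (h x ^+ 2) - (\int[P]_x h x) ^+ 2.
Proof.
move=> bh; have := expect_CS bh (ess_bdd_cst P 1).
under [X in X ^+ 2 <= _]eq_Rintegral do rewrite mulr1.
by rewrite expr1n expect_cst mulr1 subr_ge0.
Qed.

(** * Finite orthonormal systems *)

Section orthonormal.
Context {d : measure_display} {T : measurableType d} {R : realType}.
Variables (P : probability T R) (I : finType) (f : I -> T -> R).
Hypotheses (bf : forall i, ess_bdd P (f i))
  (f_on : forall i j, \int[P]_z (f i z * f j z) = (i == j)%:R).

Lemma orthonormal_norm2 (c : I -> R) :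
  \int[P]_z ((\sum_m c m * f m z) ^+ 2) = \sum_m c m ^+ 2.
Proof.
transitivity (\int[P]_z (\sum_m c m * \sum_m' c m' * (f m' z * f m z))).
  apply: eq_Rintegral => z _; rewrite expr2 mulr_suml; apply: eq_bigr => m _.
  by rewrite !mulr_sumr; apply: eq_bigr => m' _; ring.
rewrite expect_sum; last first.
  move=> m; apply: ess_bddZ; apply: ess_bdd_sum => m'.
  by apply: ess_bddZ; exact: ess_bddM.
apply: eq_bigr => m _; rewrite expectZ; last first.
  by apply: ess_bdd_sum => m'; apply: ess_bddZ; exact: ess_bddM.
rewrite expect_sum; last by move=> m'; apply: ess_bddZ; exact: ess_bddM.
rewrite (bigD1 m)//= big1 ?addr0.
  by rewrite expectZ ?f_on ?eqxx ?mulr1 ?expr2//; exact: ess_bddM.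
move=> m' m'm; rewrite expectZ; last exact: ess_bddM.
by rewrite f_on (negbTE m'm) mulr0.
Qed.

(** The residual of the projection of h has nonnegative squared norm. *)
Lemma bessel h : ess_bdd P h ->
  \sum_m (\int[P]_z (h z * f m z)) ^+ 2 <= \int[P]_z (h z ^+ 2).
Proof.
move=> bh; set th := fun m => \int[P]_z (h z * f m z).
have bs : ess_bdd P (fun z => \sum_m th m * f m z).
  by apply: ess_bdd_sum => m; exact: ess_bddZ.
rewrite -subr_ge0.
have : 0 <= \int[P]_z ((h z - \sum_m th m * f m z) ^+ 2).
  by apply: Rintegral_ge0 => z _; exact: sqr_ge0.
have hsE : \int[P]_z (h z * \sum_m th m * f m z) = \sum_m th m ^+ 2.
  transitivity (\int[P]_z (\sum_m th m * (h z * f m z))).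
    by apply: eq_Rintegral => z _; rewrite mulr_sumr; apply: eq_bigr => m _; ring.
  rewrite expect_sum; last by move=> m; apply: ess_bddZ; exact: ess_bddM.
  apply: eq_bigr => m _; rewrite expectZ ?expr2//; exact: ess_bddM.
have -> : \int[P]_z ((h z - \sum_m th m * f m z) ^+ 2) =
   \int[P]_z (h z ^+ 2) - 2 * \int[P]_z (h z * \sum_m th m * f m z) +
     \int[P]_z ((\sum_m th m * f m z) ^+ 2).
  have bhs := ess_bddM bh bs.
  rewrite -expectZ// -expectB; [|exact: ess_bddX|exact: ess_bddZ].
  rewrite -expectD; last 2 first.
  - by apply: ess_bddB; [exact: ess_bddX|exact: ess_bddZ].
  - exact: ess_bddX.
  by apply: eq_Rintegral => z _; ring.
rewrite hsE orthonormal_norm2; congr (_ <= _); rewrite /th; ring.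
Qed.

End orthonormal.

(** * Mean squared error of the single-split estimator *)

Section split_mse.
Context {d : measure_display} {T : measurableType d} {R : realType}.
Variables (P : probability T R) (A Y : T -> R) (I : finType) (f : I -> T -> R).
Hypotheses (bA : ess_bdd P A) (bY : ess_bdd P Y)
  (bf : forall i, ess_bdd P (f i))
  (f_on : forall i j, \int[P]_z (f i z * f j z) = (i == j)%:R).

Let thA i := \int[P]_z (A z * f i z).
Let thY i := \int[P]_z (Y z * f i z).

(** The covariate enters only through the values f m of the basis functions. *)
Definition split_estimator n (D1 D2 : n.-tuple T) : R :=
  n%:R^-1 * \sum_(i < n) A (tnth D2 i) * (Y (tnth D2 i) -
    n%:R^-1 * \sum_(k < n) Y (tnth D1 k) *
      \sum_(m : I) f m (tnth D1 k) * f m (tnth D2 i)).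

(** The expectation of the estimator minus the target c. *)
Definition split_bias c : R :=
  \int[P]_z (A z * Y z) - \sum_(m : I) thA m * thY m - c.

(** Empirical coefficients of the regression of Y, from the first subsample. *)
Let coef n (D1 : n.-tuple T) m := n%:R^-1 * \sum_(k < n) (Y (tnth D1 k) * f m (tnth D1 k)).

Lemma sum_coef n (D1 : n.-tuple T) (w : T) :
  n%:R^-1 * (\sum_(k < n) Y (tnth D1 k) * \sum_m f m (tnth D1 k) * f m w) =
  \sum_m coef D1 m * f m w.
Proof.
under [RHS]eq_bigr => m _ do rewrite -mulrA mulr_suml.
rewrite -mulr_sumr exchange_big/=; congr (_ * _); apply: eq_bigr => k _.
by rewrite mulr_sumr; apply: eq_bigr => m _; rewrite mulrA.
Qed.

(** The term averaged over the second subsample, given the first. *)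
Let term n (D1 : n.-tuple T) z := A z * (Y z - \sum_m coef D1 m * f m z).

Let bproj n (D1 : n.-tuple T) : ess_bdd P (fun z => \sum_m coef D1 m * f m z).
Proof. by apply: ess_bdd_sum => m; exact: ess_bddZ. Qed.

Let bterm n (D1 : n.-tuple T) : ess_bdd P (term D1).
Proof. by apply: ess_bddM => //; exact: ess_bddB. Qed.

(** The term whose average over the first subsample is the random part of the
    conditional mean of the estimator. *)
Let q z := Y z * \sum_m thA m * f m z.

Let bq : ess_bdd P q.
Proof. by apply: ess_bddM => //; apply: ess_bdd_sum => m; exact: ess_bddZ. Qed.

Lemma expect_term n (D1 : n.-tuple T) : \int[P]_z term D1 z =
  \int[P]_z (A z * Y z) - n%:R^-1 * \sum_(k < n) q (tnth D1 k).
Proof.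
have -> : n%:R^-1 * \sum_(k < n) q (tnth D1 k) = \sum_m coef D1 m * thA m.
  under [in RHS]eq_bigr do rewrite -mulrA mulr_suml.
  rewrite -mulr_sumr exchange_big/=; congr (_ * _); apply: eq_bigr => k _.
  by rewrite /q mulr_sumr; apply: eq_bigr => m _; ring.
transitivity (\int[P]_z (A z * Y z - \sum_m coef D1 m * (A z * f m z))).
  apply: eq_Rintegral => z _; rewrite /term mulrBr; congr (_ - _).
  by rewrite mulr_sumr; apply: eq_bigr => m _; ring.
rewrite expectB; [|exact: ess_bddM|]; last first.
  by apply: ess_bdd_sum => m; apply: ess_bddZ; exact: ess_bddM.
rewrite expect_sum; last by move=> m; apply: ess_bddZ; exact: ess_bddM.
by congr (_ - _); apply: eq_bigr => m _; rewrite expectZ//; exact: ess_bddM.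
Qed.

Lemma expect_q : \int[P]_z q z = \sum_m thA m * thY m.
Proof.
transitivity (\int[P]_z (\sum_m thA m * (Y z * f m z))).
  by apply: eq_Rintegral => z _; rewrite /q mulr_sumr; apply: eq_bigr => m _; ring.
rewrite expect_sum; last by move=> m; apply: ess_bddZ; exact: ess_bddM.
by apply: eq_bigr => m _; rewrite expectZ//; exact: ess_bddM.
Qed.

Lemma measurable_tuple_sum n (h : T -> R) : measurable_fun setT h ->
  measurable_fun setT (fun t : n.-tuple T => \sum_(i < n) h (tnth t i)).
Proof.
move=> mh; apply: measurable_sum => i.
by apply: (measurableT_comp mh); exact: measurable_tnth.
Qed.

Lemma measurable_split_error n c :
  measurable_fun setT (fun D : n.-tuple T * n.-tuple T =>
    ((split_estimator D.1 D.2 - c) ^+ 2)%:E).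
Proof.
have m1 h (i : 'I_n) : measurable_fun setT h ->
    measurable_fun setT (fun D : n.-tuple T * n.-tuple T => h (tnth D.1 i) : R).
  move=> mh; apply: (measurableT_comp mh).
  by apply: (measurableT_comp (measurable_tnth i)); exact: measurable_fst.
have m2 h (i : 'I_n) : measurable_fun setT h ->
    measurable_fun setT (fun D : n.-tuple T * n.-tuple T => h (tnth D.2 i) : R).
  move=> mh; apply: (measurableT_comp mh).
  by apply: (measurableT_comp (measurable_tnth i)); exact: measurable_snd.
have mA := ess_bdd_mfun bA; have mY := ess_bdd_mfun bY.
have mf m := ess_bdd_mfun (bf m).
apply/measurable_EFinP; apply: measurable_funX; apply: measurable_funB => //.
apply: measurable_funM => //; apply: measurable_sum => i.
apply: measurable_funM; first exact: m2.
apply: measurable_funB; first exact: m2.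
apply: measurable_funM => //; apply: measurable_sum => k.
apply: measurable_funM; first exact: m1.
apply: measurable_sum => m; apply: measurable_funM; first exact: m1.
exact: m2.
Qed.

Let mean n (D1 : n.-tuple T) := n%:R^-1 * (\sum_(k < n) q (tnth D1 k)) .

(** Conditionally on the first subsample the estimator is an i.i.d. average. *)
Lemma split_error_second_split n c (D1 : n.-tuple T) : (0 < n)%N ->
  (\int[iid P n]_D2 ((split_estimator D1 D2 - c) ^+ 2)%:E)%E =
  (n%:R^-1 * (\int[P]_z (term D1 z ^+ 2) - (\int[P]_z term D1 z) ^+ 2) +
   (mean D1 - (\int[P]_z (A z * Y z) - c)) ^+ 2)%:E.
Proof.
move=> n0; rewrite -[(mean D1 - _) ^+ 2]sqrrN.
have -> : - (mean D1 - (\int[P]_z (A z * Y z) - c)) = \int[P]_z term D1 z - c.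
  by rewrite expect_term /mean; ring.
rewrite -(iid_avg_second_moment c n0 (bterm D1)).
apply: eq_integral => D2 _; congr ((_ * _ - _) ^+ 2)%:E.
by apply: eq_bigr => i _; rewrite sum_coef.
Qed.

Let split_mse n c :=
  (\int[iid P n \x iid P n]_D ((split_estimator D.1 D.2 - c) ^+ 2)%:E)%E.

Let mmean n c : measurable_fun [set: n.-tuple T]
  (fun D1 => ((mean D1 - (\int[P]_z (A z * Y z) - c)) ^+ 2)%:E).
Proof.
apply/measurable_EFinP; apply: measurable_funX; apply: measurable_funB => //.
apply: measurable_funM => //; apply: measurable_tuple_sum; exact: ess_bdd_mfun bq.
Qed.

Let mean_second_moment n c : (0 < n)%N ->
  (\int[iid P n]_D1 ((mean D1 - (\int[P]_z (A z * Y z) - c)) ^+ 2)%:E)%E =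
  (n%:R^-1 * (\int[P]_z (q z ^+ 2) - (\int[P]_z q z) ^+ 2) +
   split_bias c ^+ 2)%:E.
Proof.
move=> n0; rewrite iid_avg_second_moment//; congr (_ + _)%:E.
by rewrite expect_q -sqrrN /split_bias; congr (_ ^+ 2); ring.
Qed.

Lemma split_mse_fubini n c : split_mse n c =
  (\int[iid P n]_D1 \int[iid P n]_D2 ((split_estimator D1 D2 - c) ^+ 2)%:E)%E.
Proof.
rewrite /split_mse fubini_tonelli1//; first exact: measurable_split_error.
by move=> D; rewrite lee_fin sqr_ge0.
Qed.

Let measurable_second_split n c : measurable_fun [set: n.-tuple T]
  (fun D1 => (\int[iid P n]_D2 ((split_estimator D1 D2 - c) ^+ 2)%:E)%E).
Proof.
apply: (measurable_fun_fubini_tonelli_F (m2 := iid P n)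
  (fun D => ((split_estimator D.1 D.2 - c) ^+ 2)%:E)).
  exact: measurable_split_error.
by move=> D; rewrite lee_fin sqr_ge0.
Qed.

(** Both variances, over the second and over the first subsample, are
    nonnegative. *)
Lemma split_mse_ge_bias n c : (0 < n)%N ->
  ((split_bias c ^+ 2)%:E <= split_mse n c)%E.
Proof.
move=> n0; rewrite split_mse_fubini.
have : ((split_bias c ^+ 2)%:E <=
    \int[iid P n]_D1 ((mean D1 - (\int[P]_z (A z * Y z) - c)) ^+ 2)%:E)%E.
  rewrite mean_second_moment// lee_fin lerDr mulr_ge0 ?invr_ge0//.
  exact: variance_ge0.
move/le_trans; apply; apply: ge0_le_integral => //.
- by move=> D1 _; rewrite lee_fin sqr_ge0.
- exact: mmean.
- exact: measurable_second_split.
- move=> D1 _; rewrite split_error_second_split// lee_fin lerDr.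
  rewrite mulr_ge0 ?invr_ge0//; exact: variance_ge0.
Qed.

Variable B : R.
Hypotheses (AB : {ae P, forall z, `|A z| <= B}) (YB : {ae P, forall z, `|Y z| <= B}).

Lemma bound_sqr_ae h g : ess_bdd P h -> ess_bdd P g ->
  {ae P, forall z, `|h z| <= B} ->
  \int[P]_z ((h z * g z) ^+ 2) <= B ^+ 2 * \int[P]_z (g z ^+ 2).
Proof.
move=> bh bg hB; rewrite -expectZ; last exact: ess_bddX.
apply: expect_ae_le.
- by apply: ess_bddX; exact: ess_bddM.
- by apply: ess_bddZ; exact: ess_bddX.
- apply: filterS hB => z zB; rewrite exprMn ler_wpM2r ?sqr_ge0//.
  by rewrite -(real_normK (num_real (h z))) lerXn2r ?nnegrE// (le_trans _ zB).
Qed.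

Lemma norm2_le h : ess_bdd P h -> {ae P, forall z, `|h z| <= B} ->
  \int[P]_z (h z ^+ 2) <= B ^+ 2.
Proof.
move=> bh hB; have := bound_sqr_ae bh (ess_bdd_cst P 1) hB.
under eq_Rintegral do rewrite mulr1.
by rewrite expr1n expect_cst mulr1.
Qed.

(** The variance over the second subsample is at most E[A^2 (Y - bhat)^2] / n,
    where the squared norm of bhat is the sum of the squared empirical
    coefficients.  Each of the #|I| coefficients has variance at most B^2 / n,
    which is the origin of the term in #|I| / n^2; Bessel's inequality bounds
    everything else by multiples of B^4 / n. *)
Lemma split_mse_le n c : (0 < n)%N ->
  (split_mse n c <= (split_bias c ^+ 2 +
     5 * B ^+ 4 / n%:R + 2 * B ^+ 4 * #|I|%:R / n%:R ^+ 2)%:E)%E.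
Proof.
move=> n0; rewrite split_mse_fubini; set r := n%:R^-1 : R.
have r0 : 0 <= r by rewrite invr_ge0.
pose K (D1 : n.-tuple T) : \bar R :=
  ((r * (2 * B ^+ 4))%:E + \sum_m (r * (2 * B ^+ 2) * coef D1 m ^+ 2)%:E +
   ((mean D1 - (\int[P]_z (A z * Y z) - c)) ^+ 2)%:E)%E.
have mcoef m : measurable_fun [set: n.-tuple T] (fun D1 => coef D1 m).
  apply: measurable_funM => //.
  apply: (measurable_tuple_sum (h := fun z => Y z * f m z)).
  exact: (measurable_funM (ess_bdd_mfun bY) (ess_bdd_mfun (bf m))).
have b0 : 0 <= r * (2 * B ^+ 2) by rewrite mulr_ge0// mulr_ge0// sqr_ge0.
have mcoefE m : measurable_fun [set: n.-tuple T]
    (fun D1 => (r * (2 * B ^+ 2) * coef D1 m ^+ 2)%:E).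
  apply/measurable_EFinP; apply: measurable_funM => //; exact: measurable_funX.
have coef0 m (D1 : n.-tuple T) : (0 <= (r * (2 * B ^+ 2) * coef D1 m ^+ 2)%:E)%E.
  by rewrite lee_fin mulr_ge0// sqr_ge0.
have a0 : (0 <= (r * (2 * B ^+ 4))%:E)%E.
  by rewrite lee_fin mulr_ge0// mulr_ge0// exprn_even_ge0.
have msumE : measurable_fun [set: n.-tuple T]
    (fun D1 => (\sum_m (r * (2 * B ^+ 2) * coef D1 m ^+ 2)%:E)%E).
  exact: emeasurable_sum.
have le1 : (\int[iid P n]_D1 \int[iid P n]_D2 ((split_estimator D1 D2 - c) ^+ 2)%:E
    <= \int[iid P n]_D1 K D1)%E.
  apply: ge0_le_integral => //.
  - by move=> D1 _; apply: integral_ge0 => D2 _; rewrite lee_fin sqr_ge0.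
  - exact: measurable_second_split.
  - by apply: emeasurable_funD; [exact: emeasurable_funD|exact: mmean].
  - move=> D1 _; rewrite split_error_second_split// /K sumEFin -!EFinD lee_fin lerD2r.
    have -> : r * (2 * B ^+ 4) + \sum_m r * (2 * B ^+ 2) * coef D1 m ^+ 2 =
      r * (B ^+ 2 * (2 * B ^+ 2 + 2 * \sum_m coef D1 m ^+ 2)).
      by rewrite -mulr_sumr; ring.
    rewrite -/r ler_wpM2l//.
    rewrite (@le_trans _ _ (\int[P]_z (term D1 z ^+ 2)))//.
      by rewrite lerBlDr lerDl sqr_ge0.
    apply: le_trans (bound_sqr_ae bA _ AB) _; first exact: ess_bddB.
    rewrite ler_wpM2l ?sqr_ge0//.
    apply: (@le_trans _ _ (2 * \int[P]_z (Y z ^+ 2) +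
        2 * \int[P]_z ((\sum_m coef D1 m * f m z) ^+ 2))); last first.
      rewrite orthonormal_norm2//; apply: lerD => //.
      by rewrite ler_wpM2l//; exact: norm2_le.
    rewrite -!expectZ; [|by apply: ess_bddX..].
    rewrite -expectD; [|by apply: ess_bddZ; apply: ess_bddX..].
    apply: expect_ae_le.
    + by apply: ess_bddX; exact: ess_bddB.
    + by apply: ess_bddD; apply: ess_bddZ; exact: ess_bddX.
    + apply: aeW => z; rewrite -subr_ge0; set u := Y z; set v := \sum_m _.
      have -> : 2 * u ^+ 2 + 2 * v ^+ 2 - (u - v) ^+ 2 = (u + v) ^+ 2 by ring.
      exact: sqr_ge0.
apply: le_trans le1 _; rewrite /K ge0_integralD//; last 4 first.
- by move=> D1 _; apply: adde_ge0 => //; apply: sume_ge0.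
- exact: emeasurable_funD.
- by move=> D1 _; rewrite lee_fin sqr_ge0.
- exact: mmean.
rewrite ge0_integralD//; last by move=> D1 _; apply: sume_ge0.
rewrite integral_cst// [X in (_ * X)%E]probability_setT mule1.
rewrite ge0_integral_sum// mean_second_moment//.
have coefE m : (\int[iid P n]_D1 (r * (2 * B ^+ 2) * coef D1 m ^+ 2)%:E)%E =
   (r * (2 * B ^+ 2) * (r * (\int[P]_z ((Y z * f m z) ^+ 2) - thY m ^+ 2) +
      thY m ^+ 2))%:E.
  rewrite EFinM -[X in _ = (_ * (_ + X ^+ 2)%:E)%E]subr0.
  rewrite -(iid_avg_second_moment (h := fun z => Y z * f m z) 0 n0); last exact: ess_bddM.
  rewrite -ge0_integralZl//; last 2 first.
  - apply/measurable_EFinP; apply: measurable_funX; apply: measurable_funB => //.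
    exact: mcoef.
  - by move=> D1 _; rewrite lee_fin sqr_ge0.
  by apply: eq_integral => D1 _; rewrite -EFinM subr0.
under eq_bigr do rewrite coefE.
rewrite sumEFin -!EFinD lee_fin -/r.
have thY2 : \sum_m thY m ^+ 2 <= B ^+ 2.
  by apply: le_trans (norm2_le bY YB); exact: bessel.
have thA2 : \sum_m thA m ^+ 2 <= B ^+ 2.
  by apply: le_trans (norm2_le bA AB); exact: bessel.
have q2 : \int[P]_z (q z ^+ 2) <= B ^+ 4.
  apply: le_trans (bound_sqr_ae bY _ YB) _.
    by apply: ess_bdd_sum => m; exact: ess_bddZ.
  rewrite orthonormal_norm2// (_ : B ^+ 4 = B ^+ 2 * B ^+ 2); last by ring.
  by rewrite ler_wpM2l ?sqr_ge0.
have coef2 : \sum_m (r * (2 * B ^+ 2) * (r * (\int[P]_z ((Y z * f m z) ^+ 2) -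
    thY m ^+ 2) + thY m ^+ 2)) <= r * (2 * B ^+ 2) * (r * (B ^+ 2 * #|I|%:R) + B ^+ 2).
  rewrite -mulr_sumr ler_wpM2l// big_split/= lerD// -mulr_sumr ler_wpM2l//.
  apply: (@le_trans _ _ (\sum_(m : I) B ^+ 2)); last first.
    by rewrite sumr_const mulr_natr.
  apply: ler_sum => m _; apply: (@le_trans _ _ (\int[P]_z ((Y z * f m z) ^+ 2))).
    by rewrite lerBlDr lerDl sqr_ge0.
  apply: le_trans (bound_sqr_ae bY (bf m) YB) _.
  under eq_Rintegral do rewrite expr2.
  by rewrite f_on eqxx mulr1.
have rvar : r * (\int[P]_z (q z ^+ 2) - (\int[P]_z q z) ^+ 2) <= r * B ^+ 4.
  by rewrite ler_wpM2l// (le_trans _ q2)// lerBlDr lerDl sqr_ge0.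
have -> : n%:R ^+ 2 = (r ^+ 2)^-1 by rewrite /r exprVn invrK.
rewrite invrK; move: coef2 rvar.
set x := (\sum_m _); set y := r * (_ - _) => coef2 rvar.
have -> : split_bias c ^+ 2 + 5 * B ^+ 4 * r + 2 * B ^+ 4 * #|I|%:R * r ^+ 2 =
  r * (2 * B ^+ 4) + r * (2 * B ^+ 2) * (r * (B ^+ 2 * #|I|%:R) + B ^+ 2) +
  (r * B ^+ 4 + split_bias c ^+ 2) by ring.
by rewrite !lerD.
Qed.

End split_mse.

(** * Conditional expectations *)

Section conditional.
Context {d1 d2 : measure_display} {T : measurableType d1}
  {E : measurableType d2} {R : realType}.
Variables (P : probability T R) (nu : probability E R) (X : T -> E).
Hypotheses (mX : measurable_fun [set: T] X) (XP : has_law P nu X).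

(** The Radon-Nikodym derivative of the image under X of the charge W dP. *)
Lemma cond_exp_exists W : P.-integrable [set: T] (EFin \o W) ->
  exists f, is_cond_exp P X W f.
Proof.
move=> intW.
pose ch : {charge set E -> \bar R} :=
  measure_function_pushforward__canonical__charge_Charge (induced_charge intW) mX.
have chE B : ch B = (\int[P]_(w in X @^-1` B) (W w)%:E)%E by [].
have dom : ch `<< nu.
  apply/null_content_dominatesP => B mB nB; rewrite chE.
  apply: null_set_integral; first exact: measurable_preimage.
    by apply: measurable_funTS; exact: measurable_int intW.
  exact: etrans (XP mB) nB.
pose g := Radon_Nikodym ch nu.
have gfin x : g x \is a fin_num by exact: Radon_Nikodym_fin_num.
have intg : nu.-integrable [set: E] g by exact: Radon_Nikodym_integrable.
have gE : g = EFin \o (fine \o g) by apply/funext => x /=; rewrite fineK.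
have mg : measurable_fun [set: E] (fine \o g).
  by apply/measurable_EFinP; rewrite -gE; exact: measurable_int intg.
have intgX : P.-integrable [set: T] (EFin \o ((fine \o g) \o X)).
  have -> : EFin \o ((fine \o g) \o X) = g \o X.
    by apply/funext => w /=; rewrite fineK.
  move/integrableP: intg => [mg' ig]; apply/integrableP; split.
    exact: measurableT_comp.
  rewrite -(law_ge0_integral mX XP (f := fun x => `|g x|%E))//.
  exact: measurableT_comp.
exists (fine \o g); split => // B mB.
rewrite -chE (Radon_Nikodym_integral dom mB) (law_integral mX XP)//.
- by apply: eq_integral => w _ /=; rewrite fineK.
- by have := intgX; rewrite compA -gE.
Qed.

Lemma cond_exp_unique W f g : is_cond_exp P X W f -> is_cond_exp P X W g ->
  {ae P, forall w, f (X w) = g (X w)}.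
Proof.
move=> [mf intf fE] [mg intg gE].
have mf' : measurable_fun setT (EFin \o f) by exact/measurable_EFinP.
have mg' : measurable_fun setT (EFin \o g) by exact/measurable_EFinP.
have : ae_eq nu setT (EFin \o f) (EFin \o g).
  apply: integral_ae_eq => //.
    exact: (law_integrable mX XP).
  by move=> B _ mB; rewrite !(law_integral mX XP)//= fE// gE.
move=> h; apply: (law_ae mX XP (Q := fun x => f x = g x)).
by apply: filterS h => x /(_ I) [].
Qed.

(** This rounds a function h with values in [0, m] to a sum of m indicators of
    superlevel sets, with error at most 1. *)
Lemma count_le_floor (m : nat) (t : R) : 0 <= t <= m%:R ->
  `|\sum_(i < m) (i.+1%:R <= t)%R%:R - t| <= 1.
Proof.
move=> /andP[t0 tm].
suff [H _] : (t <= m%:R -> t - 1 <= \sum_(i < m) (i.+1%:R <= t)%R%:R <= t) /\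
    (m%:R <= t -> \sum_(i < m) (i.+1%:R <= t)%R%:R = m%:R :> R).
  by rewrite ler_distl; have /andP[h1 h2] := H tm; lra.
elim: m {tm} => [|m [IH1 IH2]].
  rewrite big_ord0; split => //; lra.
rewrite big_ord_recr/=; split => tm; last first.
  by rewrite tm IH2 ?natr1// (le_trans _ tm)// ler_nat.
have [mt|tm1] := leP m.+1%:R t.
  rewrite IH2; last by rewrite (le_trans _ mt)// ler_nat.
  by have -> : true%:R = 1 :> R by []; rewrite -natr1 in tm mt *; lra.
rewrite addr0; have [/IH1//|mt] := leP t m%:R.
by rewrite IH2 ?ltW//; rewrite -natr1 in tm tm1; lra.
Qed.

(** Only indicators are tested in the definition of a conditional
    expectation; bounded functions are uniform limits of step functions. *)
Lemma expect_indic_ext (G : T -> R) (h : E -> R) (B : R) : 0 <= B ->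
  ess_bdd P G ->
  (forall S, measurable S -> \int[P]_w (G w * \1_S (X w)) = 0) ->
  measurable_fun [set: E] h -> (forall x, `|h x| <= B) ->
  \int[P]_w (G w * h (X w)) = 0.
Proof.
move=> B0 bG G0 mh hB.
have [mG [C GC]] := bG.
have bh : ess_bdd P (fun w => h (X w)).
  by apply: (@bounded_ess_bdd _ _ _ _ _ B) => //; exact: measurableT_comp.
have bi S : measurable S -> ess_bdd P (fun w => \1_S (X w) : R).
  move=> mS; apply: (@bounded_ess_bdd _ _ _ _ _ 1).
    by apply: measurableT_comp => //; exact: measurable_indic.
  by move=> w; rewrite indicE; case: (_ \in _); rewrite ?normr0 ?normr1.
have bound N : (0 < N)%N -> `|\int[P]_w (G w * h (X w))| <= `|C| / N%:R.
  move=> N0; have N0' : 0 < N%:R :> R by rewrite ltr0n.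
  pose m := (Num.truncn (N%:R * (2 * B))).+1.
  pose S i := [set x | i.+1%:R <= N%:R * (h x + B)].
  have mS i : measurable (S i).
    rewrite -[S i]setTI; apply: measurable_fun_ler => //.
    by apply: measurable_funM => //; exact: measurable_funD.
  (* h + B rounded down to a multiple of 1/N, as a sum of superlevel sets. *)
  pose g w := N%:R^-1 * \sum_(i < m) \1_(S i) (X w) - B.
  have bg : ess_bdd P g.
    apply: ess_bddB; last exact: ess_bdd_cst.
    by apply: ess_bddZ; apply: ess_bdd_sum => i; exact: bi.
  have gh w : `|h (X w) - g w| <= N%:R^-1.
    have -> : h (X w) - g w =
      - (N%:R^-1 * (\sum_(i < m) (i.+1%:R <= N%:R * (h (X w) + B))%R%:R -
          N%:R * (h (X w) + B))).
      have -> : \sum_(i < m) (i.+1%:R <= N%:R * (h (X w) + B))%R%:R =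
          \sum_(i < m) \1_(S i) (X w) :> R.
        apply: eq_bigr => i _; rewrite indicE /S; congr (nat_of_bool _)%:R.
        by apply/idP/idP; rewrite inE.
      by rewrite /g; field; rewrite gt_eqF.
    rewrite normrN normrM gtr0_norm ?invr_gt0// ler_piMr ?invr_ge0 ?(ltW N0')//.
    apply: count_le_floor; move: (hB (X w)); rewrite ler_norml => /andP[h1 h2].
    apply/andP; split; first by rewrite mulr_ge0 ?(ltW N0')//; lra.
    apply: (@le_trans _ _ (N%:R * (2 * B))).
      by rewrite ler_pM2l//; lra.
    by rewrite ltW// /m; apply: truncnS_gt.
  have g0 : \int[P]_w (G w * g w) = 0.
    transitivity (\int[P]_w (N%:R^-1 * (\sum_(i < m) (G w * \1_(S i) (X w))) -
        B * (G w * \1_setT (X w)))).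
      apply: eq_Rintegral => w _; rewrite /g indicT -mulr_sumr.
      by rewrite mulrBr mulr1 mulrCA [G w * B]mulrC.
    rewrite expectB; last 2 first.
    - by apply: ess_bddZ; apply: ess_bdd_sum => i; apply: ess_bddM => //; exact: bi.
    - by apply: ess_bddZ; apply: ess_bddM => //; exact: bi.
    rewrite !expectZ; last 2 first.
    - by apply: ess_bdd_sum => i; apply: ess_bddM => //; exact: bi.
    - by apply: ess_bddM => //; exact: bi.
    rewrite expect_sum; last by move=> i; apply: ess_bddM => //; exact: bi.
    by rewrite big1 ?G0// ?mulr0 ?subr0// => i _; exact: G0.
  rewrite -[X in `|X|]subr0 -g0 -expectB; [|exact: ess_bddM..].
  have bd : ess_bdd P (fun w => G w * h (X w) - G w * g w).
    by apply: ess_bddB; exact: ess_bddM.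
  apply: le_trans (le_normr_Rintegral _ (ess_bdd_int bd)) _ => //.
  rewrite -[leRHS](expect_cst P); apply: expect_ae_le.
  - case: bd => md [D hD]; split; first exact: measurableT_comp.
    by exists D; apply: filterS hD => w; rewrite normr_id.
  - exact: ess_bdd_cst.
  - apply: filterS GC => w Gw; rewrite -mulrBr normrM ler_pM//.
    exact: le_trans (ler_norm C).
apply/eqP; rewrite -normr_eq0 eq_le normr_ge0 andbT; apply/ler_addgt0Pl => e e0.
rewrite addr0; pose N := (Num.truncn (`|C| / e)).+1.
apply: le_trans (bound N isT) _.
by rewrite ler_pdivrMr ?ltr0n// mulrC -ler_pdivrMr// ltW// truncnS_gt.
Qed.

(** The bound on h holds only almost everywhere, so h is first cut off. *)
Lemma tower (W : T -> R) (f h : E -> R) : ess_bdd P W -> ess_bdd P (f \o X) -> is_cond_exp P X W f ->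
  measurable_fun [set: E] h -> ess_bdd P (h \o X) ->
  \int[P]_w (f (X w) * h (X w)) = \int[P]_w (W w * h (X w)).
Proof.
move=> bW bfX [mf intf fE] mh bhX; have [_ [B hB]] := bhX.
pose S := [set x | `|h x| <= B].
have mS : measurable S.
  by rewrite -[S]setTI; apply: measurable_fun_ler => //; exact: measurableT_comp.
pose h' x := h x * \1_S x.
have mh' : measurable_fun setT h'.
  by apply: measurable_funM => //; exact: measurable_indic.
have mhX' : measurable_fun setT (fun w => h' (X w)) by exact: measurableT_comp.
have hh' : {ae P, forall w, h (X w) = h' (X w)}.
  by apply: filterS hB => w hw; rewrite /h' indicE mem_set// mulr1.
have bhX' : ess_bdd P (fun w => h' (X w)) by exact: (ess_bdd_ae_eq bhX).
have bG : ess_bdd P (fun w => f (X w) - W w) by exact: ess_bddB.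
have repl g : ess_bdd P g ->
    \int[P]_w (g w * h (X w)) = \int[P]_w (g w * h' (X w)).
  move=> bg; apply: expect_ae_eq.
  - exact: ess_bdd_mfun (ess_bddM bg bhX).
  - exact: ess_bdd_mfun (ess_bddM bg bhX').
  - by apply: filterS hh' => w ->.
rewrite repl// repl//; apply/eqP; rewrite -subr_eq0 -expectB; [|exact: ess_bddM..].
under eq_Rintegral do rewrite -mulrBl.
apply/eqP; apply: (@expect_indic_ext _ _ `|B|) => //.
- move=> U mU.
  have mU' := measurable_preimage mX mU.
  have bI : ess_bdd P (fun w => \1_U (X w) : R).
    apply: (@bounded_ess_bdd _ _ _ _ _ 1).
      by apply: measurableT_comp => //; exact: measurable_indic.
    by move=> w; rewrite indicE; case: (_ \in _); rewrite ?normr0 ?normr1.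
  under eq_Rintegral do rewrite mulrBl.
  rewrite expectB; [|exact: ess_bddM..].
  have restr g : \int[P]_w (g w * \1_U (X w)) = \int[P]_(w in X @^-1` U) g w.
    rewrite [RHS]Rintegral_mkcond; apply: eq_Rintegral => w _.
    rewrite patchE indicE (_ : (w \in X @^-1` U) = (X w \in U)).
      by case: ifP; rewrite ?mulr1 ?mulr0.
    by apply/idP/idP; rewrite !inE.
  by rewrite !restr /Rintegral fE// subrr.
- move=> x; rewrite /h' indicE; have [xS|xS] := boolP (x \in S).
    by rewrite mulr1; move: xS; rewrite inE => /le_trans; apply; exact: ler_norm.
  by rewrite mulr0 normr0.
Qed.

(** The conditional expectations inside the conditional covariance are chosen
    versions, which agree almost surely with p and b; by the tower property the
    cross terms E[A b(X)] and E[p(X) Y] both equal E[p(X) b(X)]. *)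
Lemma expect_cond_cov A Y p b : ess_bdd P A -> ess_bdd P Y ->
  is_cond_exp P X A p -> is_cond_exp P X Y b ->
  ess_bdd P (p \o X) -> ess_bdd P (b \o X) ->
  \int[P]_w cond_cov P X A Y (X w) =
  \int[P]_w (A w * Y w) - \int[P]_w (p (X w) * b (X w)).
Proof.
move=> bA bY pA bY' bp bb.
set pt := cond_exp P X A; set bt := cond_exp P X Y.
have ptA : is_cond_exp P X A pt by apply: xgetPex; exists p.
have btY : is_cond_exp P X Y bt by apply: xgetPex; exists b.
have ppt := cond_exp_unique pA ptA; have bbt := cond_exp_unique bY' btY.
have mpt : measurable_fun setT pt by case: ptA.
have mbt : measurable_fun setT bt by case: btY.
have bpt : ess_bdd P (pt \o X).
  by apply: (ess_bdd_ae_eq bp) => //; exact: measurableT_comp.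
have bbt' : ess_bdd P (bt \o X).
  by apply: (ess_bdd_ae_eq bb) => //; exact: measurableT_comp.
pose W w := (A w - pt (X w)) * (Y w - bt (X w)).
have bW : ess_bdd P W by apply: ess_bddM; exact: ess_bddB.
have : is_cond_exp P X W (cond_cov P X A Y).
  by apply: xgetPex; apply: cond_exp_exists; exact: ess_bdd_int.
move=> [mc _ /(_ setT measurableT)]; rewrite preimage_setT => cE.
rewrite /Rintegral cE -/(Rintegral P setT W).
transitivity (\int[P]_w (A w * Y w) - \int[P]_w (pt (X w) * bt (X w))); last first.
  congr (_ - _); apply: expect_ae_eq.
  - exact: ess_bdd_mfun (ess_bddM bpt bbt').
  - exact: ess_bdd_mfun (ess_bddM bp bb).
  - by apply: filterS2 ppt bbt => w -> ->.
have t1 := tower bA bpt ptA mbt bbt'.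
have t2 := tower bY bbt' btY mpt bpt.
transitivity (\int[P]_w (A w * Y w) - \int[P]_w (A w * bt (X w)) -
  (\int[P]_w (Y w * pt (X w)) - \int[P]_w (pt (X w) * bt (X w)))).
  have b1 := ess_bddM bA bY; have b2 := ess_bddM bA bbt'.
  have b3 := ess_bddM bY bpt; have b4 := ess_bddM bpt bbt'.
  rewrite -(expectB b1 b2) -(expectB b3 b4).
  rewrite -(expectB (ess_bddB b1 b2) (ess_bddB b3 b4)).
  by apply: eq_Rintegral => w _; rewrite /W /=; ring.
rewrite -t1 -t2; under [X in _ - (X - _)]eq_Rintegral do rewrite mulrC.
by rewrite subrr subr0.
Qed.

End conditional.

(** * Integration over the cube *)

Section cube_integrals.
Variable R : realType.
Notation leb := (@lebesgue_measure R).
Notation U01 := (uniform_prob (@ltr01 R)).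

Lemma leb_integrable01 (h : R -> R) (B : R) : measurable_fun setT h ->
  (forall t, `|h t| <= B) -> leb.-integrable `[0, 1] (EFin \o h).
Proof.
move=> mh hB; apply: measurable_bounded_integrable => //.
- by rewrite /= lebesgue_measure_itv/= lte01 oppr0 adde0 ltry.
- exact: measurable_funTS.
- exists B; split; first exact: num_real.
  by move=> x Bx t _ /=; rewrite (le_trans (hB t))// ltW.
Qed.

Lemma expect_uniform01 (h : R -> R) (B : R) : measurable_fun setT h ->
  (forall t, `|h t| <= B) -> \int[U01]_t h t = \int[leb]_(t in `[0, 1]) h t.
Proof.
move=> mh hB.
have mhB : measurable_fun setT (fun t => h t + B) by exact: measurable_funD.
have H : \int[U01]_t (h t + B) = \int[leb]_(t in `[0, 1]) (h t + B).
  rewrite /Rintegral integral_uniform.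
  - by rewrite oppr0 addr0 invr1 mul1e.
  - exact/measurable_EFinP.
  - by move=> t; rewrite lee_fin; move: (hB t); rewrite ler_norml => /andP[? _]; lra.
have bh : ess_bdd U01 h by exact: (@bounded_ess_bdd _ _ _ _ _ B).
have := H; rewrite expectD//; last exact: ess_bdd_cst.
rewrite RintegralD//.
- rewrite expect_cst Rintegral_cst//= lebesgue_measure_itv/= lte01 oppr0 adde0 mulr1.
  exact: addIr.
- exact: leb_integrable01 hB.
- exact: (@leb_integrable01 (cst B) `|B|).
Qed.

Variable d : nat.
Notation space := (Defs.point R d).
Notation U := (unif_cube R d).

Let in01 (t : R) : R := \1_`[0, 1] t.

Let min01 : measurable_fun setT in01.
Proof. exact: measurable_indic. Qed.

Let cubeE (x : space) : (\prod_(i < d) in01 (tnth x i) = \1_(@cube R d) x).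
Proof.
rewrite indicE; have [/set_mem xc|xc] := boolP (x \in @cube R d).
  rewrite big1// => i _; rewrite /in01 indicE mem_set//=.
  by rewrite in_itv/=; exact: xc.
have : ~ cube x by move=> xc'; move/negP: xc; apply; rewrite inE.
move=> /existsNP[i xi]; rewrite (bigD1 i)//= /in01 indicE memNset ?mul0r//.
Qed.

Lemma measurable_cube : measurable (@cube R d).
Proof.
rewrite (_ : @cube R d = [set x : space | 1 <= \prod_(i < d) in01 (tnth x i)]).
  rewrite -[X in measurable X]setTI; apply: measurable_fun_ler => //.
  apply: measurable_prod => i _; apply: measurableT_comp => //.
  exact: measurable_tnth.
apply/seteqP; split => x /=; rewrite cubeE indicE.
  by move=> xc; rewrite mem_set.
by have [/set_mem//|_] := boolP (x \in _); rewrite ler10.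
Qed.

Lemma expect_prod (h : 'I_d -> R -> R) :
  (forall i, measurable_fun setT (h i)) ->
  (forall i, exists B : R, forall t, `|h i t| <= B) ->
  \int[U]_x (\prod_(i < d) h i (tnth x i)) =
  \prod_(i < d) \int[leb]_(t in `[0, 1]) h i t.
Proof.
move=> mh bh; rewrite iid_expect_prod//; apply: eq_bigr => i _.
by have [B hB] := bh i; exact: expect_uniform01 hB.
Qed.

Lemma cube_ae : {ae U, forall x, cube x}.
Proof.
have H : (U (@cube R d)) = 1%E.
  rewrite -[LHS]fineK; last exact: fin_num_measure measurable_cube.
  have -> : fine (U (@cube R d)) = \int[U]_x (\prod_(i < d) in01 (tnth x i)).
    under eq_Rintegral do rewrite cubeE.
    by rewrite /Rintegral integral_indic ?setIT//; exact: measurable_cube.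
  rewrite (expect_prod (h := fun=> in01)); last 2 first.
  - by [].
  - move=> i; exists 1 => t; rewrite /in01 indicE.
    by case: (_ \in _); rewrite ?normr0 ?normr1.
  rewrite big1// => i _; rewrite (@eq_Rintegral _ _ _ _ _ (cst 1)); last first.
    by move=> t t01; rewrite /in01 indicE t01.
  by rewrite Rintegral_cst//= lebesgue_measure_itv/= lte01 oppr0 adde0 mulr1.
exists (~` @cube R d); split => //; first exact: measurableC measurable_cube.
by have := probability_setC U measurable_cube; rewrite H subee.
Qed.

Lemma cube_ess_bdd (f : space -> R) (B : R) : measurable_fun setT f ->
  (forall x, cube x -> `|f x| <= B) -> ess_bdd U f.
Proof.
by move=> mf fB; split => //; exists B; apply: filterS cube_ae => x; exact: fB.
Qed.

Lemma innerE (f g : space -> R) : measurable_fun setT f -> measurable_fun setT g ->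
  inner f g = \int[U]_x (f x * g x).
Proof.
move=> mf mg; rewrite /inner Rintegral_mkcond; apply: expect_ae_eq.
- apply/(measurable_restrictT _ measurable_cube).
  by apply: measurable_funTS; exact: measurable_funM.
- exact: measurable_funM.
- by apply: filterS cube_ae => x xc; rewrite patchE mem_set.
Qed.

Lemma inner_prod (f g : 'I_d -> R -> R) :
  (forall i, measurable_fun setT (f i)) -> (forall i, measurable_fun setT (g i)) ->
  (forall i, exists B : R, forall t, `|f i t| <= B) ->
  (forall i, exists B : R, forall t, `|g i t| <= B) ->
  inner (fun x : space => \prod_(i < d) f i (tnth x i))
        (fun x => \prod_(i < d) g i (tnth x i)) =
  \prod_(i < d) inner01 (f i) (g i).
Proof.
move=> mf mg bf bg.
have mprod (h : 'I_d -> R -> R) : (forall i, measurable_fun setT (h i)) ->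
    measurable_fun setT (fun x : space => \prod_(i < d) h i (tnth x i)).
  move=> mh; apply: measurable_prod => i _; apply: (measurableT_comp (mh i)).
  exact: measurable_tnth.
rewrite innerE; [|exact: mprod..].
under eq_Rintegral do rewrite -big_split/=.
rewrite (expect_prod (h := fun i t => f i t * g i t))//.
  by move=> i; exact: measurable_funM.
move=> i; have [B fB] := bf i; have [C gC] := bg i.
by exists (B * C) => t; rewrite normrM ler_pM.
Qed.

(** Walking from the origin to x in N equal steps bounds h x. *)
Lemma unif_continuous_bounded (h : space -> R) : unif_continuous_cube h ->
  exists B : R, forall x, cube x -> `|h x| <= B.
Proof.
move=> /(_ 1 ltr01)[r r0 hr].
pose N := (Num.truncn r^-1).+1.
have N0 : 0 < N%:R :> R by rewrite ltr0n.
have Nr : N%:R^-1 < r.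
  by rewrite -[r]invrK ltf_pV2 ?posrE ?invr_gt0// truncnS_gt.
pose pt (x : space) (k : nat) : space := [tuple k%:R / N%:R * tnth x i | i < d].
have ptE x k i : tnth (pt x k) i = k%:R / N%:R * tnth x i by rewrite tnth_mktuple.
have ptc x k : cube x -> (k <= N)%N -> cube (pt x k).
  move=> xc kN i; rewrite ptE; have /andP[x0 x1] := xc i.
  have k1 : k%:R / N%:R <= 1 :> R by rewrite ler_pdivrMr// mul1r ler_nat.
  have k0 : 0 <= k%:R / N%:R :> R by rewrite divr_ge0.
  by rewrite mulr_ge0//= mulr_ile1.
pose o : space := [tuple 0 | i < d].
exists (`|h o| + N%:R) => x xc.
have step k : (k <= N)%N -> `|h (pt x k)| <= `|h o| + k%:R.
  elim: k => [_|k IH kN].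
    rewrite addr0 (_ : pt x 0%N = o)//; apply/eq_from_tnth => i.
    by rewrite ptE !mul0r tnth_mktuple.
  have kN' := ltnW kN.
  have : `|h (pt x k.+1) - h (pt x k)| < 1.
    apply: hr; [exact: ptc|exact: ptc|] => i; rewrite !ptE -mulrBl -mulrBl.
    have -> : k.+1%:R - k%:R = 1 :> R by rewrite -natr1 addrC addKr.
    have /andP[x0 x1] := xc i.
    rewrite mul1r ger0_norm; last by rewrite mulr_ge0// invr_ge0 ltW.
    by rewrite (le_lt_trans _ Nr)// ler_piMr// invr_ge0 ltW.
  move=> h1; rewrite -natr1 addrA.
  have := ler_normD (h (pt x k.+1) - h (pt x k)) (h (pt x k)).
  by rewrite subrK; have := IH kN'; lra.
have -> : x = pt x N.
  by apply/eq_from_tnth => i; rewrite ptE divff ?mul1r// gt_eqF.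
exact: step.
Qed.

End cube_integrals.

(** * Localisation of the one-dimensional basis functions *)

Section atoms.
Variables (R : realType) (S J0 : nat) (W : cdv_basis R S J0).
Notation leb := (@lebesgue_measure R).

(** Scaling functions and wavelets of a level under one index type, which is
    what expanding products over the d coordinates calls for. *)
Definition atom j (s : bool * 'I_(2 ^ j)) : R -> R :=
  if s.1 then wavelet W s.2 else scaling W s.2.

Lemma continuous_compact_support_bounded (g : R -> R) (B : R) : continuous g ->
  (forall t, B < `|t| -> g t = 0) -> exists2 C : R, 0 <= C & forall t, `|g t| <= C.
Proof.
move=> cg gB.
have cgn : {within `[- `|B|, `|B|], continuous (fun t => `|g t|)}.
  apply: continuous_subspaceT => t.
  by apply: continuous_comp; [exact: cg|exact: norm_continuous].
have BB : - `|B| <= `|B| by rewrite (le_trans _ (normr_ge0 B))// oppr_le0.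
have [c _ hc] := EVT_max BB cgn.
exists `|g c| => // t; have [tB|Bt] := leP `|t| `|B|.
  by apply: hc; rewrite in_itv/= -ler_norml.
by rewrite gB ?normr0// (le_lt_trans _ Bt)// ler_norm.
Qed.

(** There are finitely many continuous, compactly supported shapes, so one
    radius B and one bound C serve all levels and positions. *)
Lemma atom_shape : exists B C : R, [/\ 0 <= B, 0 <= C &
  forall j (s : bool * 'I_(2 ^ j)), (J0 <= j)%N ->
  [/\ continuous (atom s),
      forall t, `|atom s t| <= C * Num.sqrt (2 ^+ j) &
      forall t, B < `|2 ^+ j * t - s.2%:R| -> atom s t = 0]].
Proof.
have [N [g [cg gsupp gS gW]]] := cdv_dyadic W.
have [Bs hB] := choice gsupp.
have /choice[Cs hC] : forall s, exists C : R, 0 <= C /\ forall t, `|g s t| <= C.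
  move=> s; have [C C0 gC] := continuous_compact_support_bounded (cg s) (hB s).
  by exists C.
exists (\sum_s `|Bs s|), (\sum_s Cs s); split.
- exact: sumr_ge0.
- by apply: sumr_ge0 => s _; have [] := hC s.
- move=> j [b m] jJ.
  have [s sE] : exists s, forall t,
      atom (b, m) t = Num.sqrt (2 ^+ j) * g s (2 ^+ j * t - m%:R).
    by rewrite /atom; case: b => /=; [exact: gW|exact: gS].
  split.
  + have -> : atom (b, m) = (fun t => Num.sqrt (2 ^+ j) * g s (2 ^+ j * t - m%:R)).
      exact/funext.
    have c1 : continuous (fun t : R => 2 ^+ j * t - m%:R).
      move=> t; apply: cvgB; last exact: cvg_cst.
      by apply: cvgM; [exact: cvg_cst|exact: cvg_id].
    move=> t; apply: cvgM; first exact: cvg_cst.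
    exact: (@continuous_comp R R R _ (g s) t (c1 t) (cg s _)).
  + move=> t; rewrite sE normrM ger0_norm ?sqrtr_ge0// mulrC ler_wpM2r ?sqrtr_ge0//.
    rewrite (le_trans ((hC s).2 _))// (bigD1 s)//= lerDl.
    by apply: sumr_ge0 => s' _; have [] := hC s'.
  + move=> t tB; rewrite sE hB ?mulr0// (le_lt_trans _ tB)//.
    rewrite (le_trans (ler_norm _))// (bigD1 s)//= lerDl.
    exact: sumr_ge0.
Qed.

Lemma measurable_atom j (s : bool * 'I_(2 ^ j)) : (J0 <= j)%N ->
  measurable_fun setT (atom s).
Proof.
have [B [C [_ _ H]]] := atom_shape => jJ; have [cs _ _] := H j s jJ.
exact: continuous_measurable_fun.
Qed.

Lemma atom_bounded j (s : bool * 'I_(2 ^ j)) : (J0 <= j)%N ->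
  exists K : R, forall t, `|atom s t| <= K.
Proof.
have [B [C [_ _ H]]] := atom_shape => jJ; have [_ hb _] := H j s jJ.
by eexists; exact: hb.
Qed.

Lemma count_window (N a k : nat) :
  (\sum_(i < N) (a <= i < a + k) <= k)%N.
Proof.
have -> : (\sum_(i < N) (a <= i < a + k) = minn N (a + k) - minn N a)%N.
  elim: N => [|N IH]; first by rewrite big_ord0; lia.
  by rewrite big_ord_recr/= IH; lia.
lia.
Qed.

(** All integers within b of a given point lie within 2b of any one of them. *)
Lemma count_near (N b : nat) (u : R) :
  \sum_(i < N) (`|u - i%:R| <= b%:R)%R%:R <= (4 * b + 1)%:R :> R.
Proof.
have [[i0 hi0]|no] := pselect (exists i : 'I_N, `|u - i%:R| <= b%:R); last first.
  rewrite big1 ?ler0n// => i _; case: (boolP (_ <= _)) => // h.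
  by case: no; exists i.
rewrite -natr_sum ler_nat.
apply: leq_trans (count_window N (i0 - 2 * b) (4 * b + 1)).
apply: leq_sum => i _; case: (boolP (`|u - i%:R| <= b%:R)) => // hi.
have : `|i%:R - i0%:R| <= (2 * b)%:R :> R.
  have -> : i%:R - i0%:R = (u - i0%:R) - (u - i%:R) by ring.
  by rewrite (le_trans (ler_normB _ _))// mul2n -addnn natrD lerD.
rewrite ler_norml => /andP[h1 h2].
have : i%:R <= (i0 + 2 * b)%:R :> R by rewrite natrD; lra.
have : i0%:R <= (i + 2 * b)%:R :> R by rewrite natrD; lra.
rewrite !ler_nat => g1 g2.
by have -> : (i0 - 2 * b <= i < i0 - 2 * b + (4 * b + 1))%N by lia.
Qed.

(** At each point only boundedly many atoms of a level are nonzero. *)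
Lemma atom_sum_bound : exists2 K : R, 0 <= K &
  forall j (b : bool) t, (J0 <= j)%N ->
  \sum_(m < 2 ^ j) `|atom (b, m) t| <= K * Num.sqrt (2 ^+ j).
Proof.
have [B [C [B0 C0 H]]] := atom_shape.
pose b0 := (Num.truncn B).+1.
exists ((4 * b0 + 1)%:R * C); first by rewrite mulr_ge0.
move=> j b t jJ.
have h (m : 'I_(2 ^ j)) : `|atom (b, m) t| <=
    (`|2 ^+ j * t - m%:R| <= b0%:R)%R%:R * (C * Num.sqrt (2 ^+ j)).
  have [_ hb hs] := H j (b, m) jJ.
  have [hm|] := boolP (`|2 ^+ j * t - m%:R| <= b0%:R); first by rewrite mul1r.
  rewrite -ltNge => hm; rewrite hs ?normr0 ?mul0r// (lt_trans _ hm)//; exact: truncnS_gt.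
apply: le_trans (ler_sum _ (fun m _ => h m)) _.
by rewrite -mulr_suml -mulrA ler_wpM2r ?mulr_ge0 ?sqrtr_ge0//; exact: count_near.
Qed.

Lemma atom_on j (s s' : bool * 'I_(2 ^ j)) : (J0 <= j)%N ->
  inner01 (atom s) (atom s') = (s == s')%:R.
Proof.
case: s s' => [[] m] [[] m'] jJ; rewrite /atom xpair_eqE/=.
- by rewrite cdv_wavelet_on// eqxx.
- rewrite /inner01; under eq_Rintegral do rewrite mulrC.
  exact: cdv_scaling_wavelet.
- exact: cdv_scaling_wavelet.
- exact: cdv_scaling_on.
Qed.

Lemma inner01_suml (I : finType) (c : I -> R) (e : I -> R -> R) (f g : R -> R) :
  (forall i, measurable_fun setT (e i)) ->
  (forall i, exists K : R, forall t, `|e i t| <= K) ->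
  measurable_fun setT g -> (exists K : R, forall t, `|g t| <= K) ->
  (forall t, 0 <= t <= 1 -> f t = \sum_i c i * e i t) ->
  inner01 f g = \sum_i c i * inner01 (e i) g.
Proof.
move=> me be mg [K gK] fE.
have be' := choice be; have [Ks eK] := be'.
have meg i : measurable_fun setT (fun t => c i * (e i t * g t)).
  by apply: measurable_funM => //; exact: measurable_funM.
have beg i t : `|c i * (e i t * g t)| <= `|c i| * (Ks i * K).
  by rewrite normrM ler_wpM2l// normrM ler_pM.
transitivity (\int[leb]_(t in `[0, 1]) (\sum_i c i * (e i t * g t))).
  apply: eq_Rintegral => t /set_mem/=; rewrite in_itv/= => t01.
  rewrite fE// mulr_suml; apply: eq_bigr => i _; ring.
rewrite -(expect_uniform01 (B := \sum_i `|c i| * (Ks i * K))).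
- rewrite expect_sum.
    apply: eq_bigr => i _; rewrite expectZ.
      congr (_ * _); rewrite (expect_uniform01 (B := Ks i * K))//.
        exact: measurable_funM.
      by move=> t; rewrite normrM ler_pM.
    apply: (@bounded_ess_bdd _ _ _ _ _ (Ks i * K)).
      exact: (measurable_funM (me i) mg).
    by move=> t; rewrite normrM ler_pM.
  by move=> i; apply: bounded_ess_bdd; [exact: meg|exact: beg].
- exact: measurable_sum.
- by move=> t; rewrite (le_trans (ler_norm_sum _ _ _))//; apply: ler_sum => i _.
Qed.

Lemma inner01C f g : inner01 f g = inner01 g f :> R.
Proof. by rewrite /inner01; under eq_Rintegral do rewrite mulrC. Qed.

(** The scaling functions of level j+1 and the atoms of level j are two
    orthonormal bases of the same space, so the transition matrix c and its
    transpose convert either into the other. *)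
Lemma two_scale j : (J0 <= j)%N ->
  exists c : 'I_(2 ^ j.+1) -> bool * 'I_(2 ^ j) -> R,
    (forall m t, 0 <= t <= 1 -> scaling W m t = \sum_s c m s * atom s t) /\
    (forall s t, 0 <= t <= 1 -> atom s t = \sum_m c m s * scaling W m t).
Proof.
move=> jJ; have jJ' : (J0 <= j.+1)%N by rewrite ltnW.
have msc m : measurable_fun setT (scaling W (j := j.+1) m).
  exact: (measurable_atom (false, m)).
have bsc m : exists K : R, forall t, `|scaling W (j := j.+1) m t| <= K.
  exact: (atom_bounded (false, m)).
have down (m : 'I_(2 ^ j.+1)) : exists c : bool * 'I_(2 ^ j) -> R, forall t, 0 <= t <= 1 ->
    scaling W m t = \sum_s c s * atom s t.
  have [c cE] := cdv_scaling_down W m jJ.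
  exists (fun s => if s.1 then c (inr s.2) else c (inl s.2)) => t t01.
  rewrite cE// big_sumType/= addrC.
  transitivity (\sum_(b : bool) \sum_(i : 'I_(2 ^ j))
    (if b then c (inr i) else c (inl i)) * atom (b, i) t).
    by rewrite big_bool.
  by rewrite pair_big/=; apply: eq_bigr => -[].
have up (s : bool * 'I_(2 ^ j)) : exists c : 'I_(2 ^ j.+1) -> R, forall t, 0 <= t <= 1 ->
    atom s t = \sum_m c m * scaling W m t.
  case: s => [[] m]; first exact: (cdv_wavelet_up W m jJ).
  exact: (cdv_scaling_up W m jJ).
have [c cE] := choice down; have [c' c'E] := choice up.
exists c; split => // s t t01; rewrite c'E//; apply: eq_bigr => m _; congr (_ * _).
transitivity (inner01 (atom s) (scaling W m)).
  rewrite (inner01_suml (c := c' s) (e := fun m => scaling W m))//; last exact: c'E.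
  rewrite (bigD1 m)//= big1 ?addr0.
    by rewrite cdv_scaling_on// eqxx mulr1.
  by move=> m' m'm; rewrite cdv_scaling_on// (negbTE m'm) mulr0.
rewrite inner01C (inner01_suml (c := c m) (e := fun s => atom s))//.
- rewrite (bigD1 s)//= big1 ?addr0.
    by rewrite atom_on// eqxx mulr1.
  by move=> s' s's; rewrite atom_on// (negbTE s's) mulr0.
- by move=> s'; exact: measurable_atom.
- by move=> s'; exact: atom_bounded.
- exact: measurable_atom.
- exact: atom_bounded.
- exact: cE.
Qed.

End atoms.

(** * Tensor-product wavelets and the projection form *)

Section tensor.
Variables (R : realType) (S J0 : nat) (W : cdv_basis R S J0) (d : nat).
Notation leb := (@lebesgue_measure R).
Notation space := (Defs.point R d).
Notation U := (unif_cube R d).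

Definition tensor j (s : {ffun 'I_d -> bool * 'I_(2 ^ j)}) (x : space) : R :=
  \prod_(i < d) atom W (s i) (tnth x i).

Lemma PhiE j (m : loc d j) : Phi W m = tensor [ffun i => (false, m i)].
Proof. by apply/funext => x; apply: eq_bigr => i _; rewrite ffunE. Qed.

Lemma PsiE j iota (m : loc d j) :
  Psi W iota m = tensor [ffun i => (iota i, m i)].
Proof.
apply/funext => x; apply: eq_bigr => i _; rewrite ffunE /atom/=.
by case: (iota i).
Qed.

Lemma measurable_tensor j (s : {ffun 'I_d -> bool * 'I_(2 ^ j)}) :
  (J0 <= j)%N -> measurable_fun setT (tensor s).
Proof.
move=> jJ; apply: measurable_prod => i _.
apply: (measurableT_comp (measurable_atom W (s i) jJ)); exact: measurable_tnth.
Qed.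

Lemma tensor_ess_bdd j (s : {ffun 'I_d -> bool * 'I_(2 ^ j)}) :
  (J0 <= j)%N -> ess_bdd U (tensor s).
Proof.
move=> jJ; have /choice[K hK] := fun i => atom_bounded W (s i) jJ.
apply: (@bounded_ess_bdd _ _ _ _ _ (\prod_i K i)); first exact: measurable_tensor.
by move=> x; rewrite normr_prod; apply: ler_prod => i _; rewrite normr_ge0 hK.
Qed.

Lemma tensor_on j (s s' : {ffun 'I_d -> bool * 'I_(2 ^ j)}) : (J0 <= j)%N ->
  inner (tensor s) (tensor s') = (s == s')%:R.
Proof.
move=> jJ; rewrite (inner_prod (f := fun i => atom W (s i))
  (g := fun i => atom W (s' i))); last 4 first.
- by move=> i; exact: measurable_atom.
- by move=> i; exact: measurable_atom.
- by move=> i; exact: atom_bounded.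
- by move=> i; exact: atom_bounded.
under eq_bigr do rewrite atom_on//.
have [->|/eqP ss'] := eqVneq s s'; first by rewrite big1// => i _; rewrite eqxx.
have [i /eqP si] : exists i, s i <> s' i.
  by apply/existsNP => h; apply: ss'; apply/ffunP.
by rewrite (bigD1 i)//= (negbTE si) mul0r.
Qed.

Lemma inner_sumr (I : finType) (c : I -> R) (e : I -> space -> R) (p f : space -> R) :
  ess_bdd U p -> (forall i, ess_bdd U (e i)) ->
  (forall x, cube x -> f x = \sum_i c i * e i x) ->
  inner p f = \sum_i c i * inner p (e i).
Proof.
move=> bp be fE.
transitivity (inner p (fun x => \sum_i c i * e i x)).
  by apply: eq_Rintegral => x /set_mem xc; rewrite fE.
rewrite innerE; [|exact: ess_bdd_mfun bp|]; last first.
  by apply: ess_bdd_mfun; apply: ess_bdd_sum => i; apply: ess_bddZ; exact: be.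
transitivity (\int[U]_x (\sum_i c i * (p x * e i x))).
  by apply: eq_Rintegral => x _; rewrite mulr_sumr; apply: eq_bigr => i _; ring.
rewrite expect_sum; last by move=> i; apply: ess_bddZ; exact: ess_bddM.
apply: eq_bigr => i _; rewrite expectZ; last exact: ess_bddM.
by rewrite innerE//; [exact: ess_bdd_mfun bp|exact: ess_bdd_mfun (be i)].
Qed.

(** The inner product of the projections of p and b onto V_j. *)
Definition proj_form j (p b : space -> R) : R :=
  \sum_(m : loc d j) inner p (Phi W m) * inner b (Phi W m).

(** The inner product of p with the component of b orthogonal to V_j; it is the
    bias of the estimator. *)
Definition resid_form j (p b : space -> R) : R := inner p b - proj_form j p b.

(** Both families of the two-scale relation are orthonormal bases of V_(l+1),
    so the projection form may be computed in either. *)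
Lemma proj_form_succ l p b : (J0 <= l)%N -> ess_bdd U p -> ess_bdd U b ->
  proj_form l.+1 p b =
  \sum_(s : {ffun 'I_d -> bool * 'I_(2 ^ l)}) inner p (tensor s) * inner b (tensor s).
Proof.
move=> lJ bp bb; have lJ' : (J0 <= l.+1)%N by rewrite ltnW.
have [c [down up]] := two_scale W lJ.
pose C (m : loc d l.+1) (s : {ffun 'I_d -> bool * 'I_(2 ^ l)}) :=
  \prod_(i < d) c (m i) (s i).
have PhiS (m : loc d l.+1) x : cube x -> Phi W m x = \sum_s C m s * tensor s x.
  move=> xc; transitivity (\prod_(i < d) \sum_s c (m i) s * atom W s (tnth x i)).
    by apply: eq_bigr => i _; exact: down.
  by rewrite bigA_distr_bigA; apply: eq_bigr => s _; rewrite big_split.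
have tensorS s x : cube x -> tensor s x = \sum_(m : loc d l.+1) C m s * Phi W m x.
  move=> xc; transitivity (\prod_(i < d) \sum_m c m (s i) * scaling W m (tnth x i)).
    by apply: eq_bigr => i _; exact: up.
  by rewrite bigA_distr_bigA; apply: eq_bigr => m _; rewrite big_split.
have bPhi (m : loc d l.+1) : ess_bdd U (Phi W m) by rewrite PhiE; exact: tensor_ess_bdd.
have bten s : ess_bdd U (tensor s) := tensor_ess_bdd s lJ.
rewrite /proj_form.
under eq_bigr => m _ do rewrite (inner_sumr bb bten (PhiS m)) mulr_sumr.
rewrite exchange_big/=; apply: eq_bigr => s _.
rewrite (inner_sumr bp bPhi (tensorS s)) mulr_suml.
by apply: eq_bigr => m _; ring.
Qed.

Lemma inner_detail_le a M h l (iota : {ffun 'I_d -> bool}) (m : loc d l) :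
  holder_ball W a M h -> (J0 <= l)%N -> iota != [ffun=> false] ->
  `|inner h (Psi W iota m)| <= M * 2 `^ (- (l%:R * (a + d%:R / 2))).
Proof.
move=> [_ hM] lJ iota0.
have c0 : 0 <= coarse_norm W a h.
  by rewrite mulr_ge0 ?powR_ge0//; exact: bigmax_ge_id.
have : ((2 `^ (l%:R * (a + d%:R / 2)) * `|inner h (Psi W iota m)|)%:E <= M%:E)%E.
  apply: (@le_trans _ _ (detail_norm W a h)).
    by apply: ereal_sup_ubound; exists l, iota, m.
  apply: le_trans hM; rewrite leeDr// lee_fin//.
rewrite lee_fin powRN -ler_pdivlMl ?powR_gt0//.
by rewrite mulrC.
Qed.

Lemma card_tensor l : #|{ffun 'I_d -> bool * 'I_(2 ^ l)}| = (2 ^ d * 2 ^ (l * d))%N.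
Proof. by rewrite card_ffun card_prod card_bool !card_ord expnMn expnM. Qed.

(** The atoms of level l that are not pure products of scaling functions are the
    wavelets of level l: at most 2^d 2^(ld) of them, with coefficient products
    bounded by M^2 2^(-l(al + be + d)). *)
Lemma proj_form_detail l al be M p b : (J0 <= l)%N ->
  ess_bdd U p -> ess_bdd U b -> holder_ball W al M p -> holder_ball W be M b ->
  `|proj_form l.+1 p b - proj_form l p b| <=
    2 ^+ d * M ^+ 2 * (2 `^ (- (al + be))) ^+ l.
Proof.
move=> lJ bp bb hp hb; rewrite proj_form_succ//.
pose coarse (s : {ffun 'I_d -> bool * 'I_(2 ^ l)}) := [forall i, ~~ (s i).1].
rewrite (bigID coarse)/=.
have -> : \sum_(s | coarse s) inner p (tensor s) * inner b (tensor s) =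
    proj_form l p b.
  rewrite (reindex (fun m : loc d l => [ffun i => (false, m i)])); last first.
    exists (fun s : {ffun 'I_d -> bool * 'I_(2 ^ l)} => [ffun i => (s i).2]).
      by move=> m _; apply/ffunP => i; rewrite !ffunE.
    move=> s /forallP sc; apply/ffunP => i; rewrite !ffunE.
    by have := sc i; case: (s i) => -[].
  rewrite /proj_form; apply: eq_big => [m|m _]; last by rewrite !PhiE.
  by apply/forallP => i; rewrite ffunE.
rewrite [_ + _ - _]addrC addKr (le_trans (ler_norm_sum _ _ _))//.
have bound s : ~~ coarse s -> `|inner p (tensor s) * inner b (tensor s)| <=
    M ^+ 2 * (2 `^ (- (al + be))) ^+ l / 2 ^+ (l * d).
  move=> sc.
  pose iota : {ffun 'I_d -> bool} := [ffun i => (s i).1].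
  pose m : loc d l := [ffun i => (s i).2].
  have sE : tensor s = Psi W iota m.
    by rewrite PsiE; congr tensor; apply/ffunP => i; rewrite !ffunE; case: (s i).
  have iota0 : iota != [ffun=> false].
    apply: contraNneq sc => /ffunP h; apply/forallP => i.
    by have := h i; rewrite !ffunE => ->.
  have h1 := inner_detail_le m hp lJ iota0.
  have h2 := inner_detail_le m hb lJ iota0.
  rewrite normrM sE; apply: le_trans (ler_pM _ _ h1 h2) _ => //.
  rewrite mulrACA -expr2 -mulrA ler_wpM2l ?sqr_ge0//.
  rewrite -powRD; last by rewrite pnatr_eq0 implybT.
  rewrite -[_ ^+ l]powR_mulrn ?powR_ge0// -powRrM.
  have -> : (2 ^+ (l * d))^-1 = 2 `^ (- (l * d)%:R) :> R.
    by rewrite powRN powR_mulrn.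
  rewrite -powRD; last by rewrite pnatr_eq0 implybT.
  by rewrite le_eqVlt; apply/orP; left; apply/eqP; congr (_ `^ _); rewrite natrM; field.
apply: (@le_trans _ _ (\sum_(s : {ffun 'I_d -> bool * 'I_(2 ^ l)})
    M ^+ 2 * (2 `^ (- (al + be))) ^+ l / 2 ^+ (l * d))).
  rewrite [leRHS](bigID coarse)/= -[leLHS]add0r lerD//; last exact: ler_sum.
  apply: sumr_ge0 => s _; rewrite mulr_ge0 ?invr_ge0 ?exprn_ge0//.
  by rewrite mulr_ge0 ?sqr_ge0// exprn_ge0// powR_ge0.
rewrite sumr_const card_tensor -[leLHS]mulr_natl natrM !natrX.
rewrite le_eqVlt; apply/orP; left; apply/eqP; field.
by rewrite expf_neq0.
Qed.

End tensor.

(** * Decay of the truncation bias *)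

Section approximation.
Variables (R : realType) (S J0 : nat) (W : cdv_basis R S J0) (d : nat).
Notation leb := (@lebesgue_measure R).
Notation space := (Defs.point R d).
Notation U := (unif_cube R d).

(** An integrand of size 2^(j/2) on an interval of length of order 2^(-j). *)
Lemma scaling_mean_bound : exists2 K : R, 0 <= K &
  forall j (m : 'I_(2 ^ j)), (J0 <= j)%N ->
  `|inner01 (cst 1) (scaling W m)| * Num.sqrt (2 ^+ j) <= K.
Proof.
have [B [C [B0 C0 H]]] := atom_shape W.
exists (C * (2 * B)); first by rewrite !mulr_ge0.
move=> j m jJ; have [_ hb hs] := H j (false, m) jJ.
have msc : measurable_fun setT (scaling W m) := measurable_atom W (false, m) jJ.
set r := Num.sqrt (2 ^+ j) in hb *.
have p2 : 0 < 2 ^+ j :> R by rewrite exprn_gt0.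
have r0 : 0 < r by rewrite sqrtr_gt0.
have rr : r * r = 2 ^+ j by rewrite -expr2 sqr_sqrtr ?ltW.
pose u := (m%:R - B) / 2 ^+ j; pose v := (m%:R + B) / 2 ^+ j.
pose ind (t : R) : R := \1_`[u, v] t.
have mind : measurable_fun setT ind by exact: measurable_indic.
have uv : v - u = 2 * B / 2 ^+ j by rewrite /u /v; ring.
have ind01 : \int[leb]_(t in `[0, 1]) ind t <= 2 * B / 2 ^+ j.
  rewrite -uv /Rintegral integral_indic//.
  have luv : leb (`[u, v]%classic) = (v - u)%:E.
    have uv' : u <= v by rewrite -subr_ge0 uv !mulr_ge0// invr_ge0 ltW.
    rewrite lebesgue_measure_itv/= lte_fin; case: ltP => // vu.
    by rewrite (_ : v = u) ?subrr//; apply/eqP; rewrite eq_le uv' vu.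
  rewrite -lee_fin fineK.
    by rewrite -luv; apply: le_measure; rewrite ?inE//; exact: measurableI.
  rewrite ge0_fin_numE// (@le_lt_trans _ _ (leb (`[u, v]%classic)))//.
    by apply: le_measure; rewrite ?inE//; exact: measurableI.
  by rewrite luv ltry.
have le1 : `|inner01 (cst 1) (scaling W m)| <= \int[leb]_(t in `[0, 1]) (C * r * ind t).
  have bsc t : `|cst 1 t * scaling W m t| <= C * r.
    by rewrite mul1r; exact: hb.
  have m1 : measurable_fun setT (fun t => cst 1 t * scaling W m t : R).
    exact: measurable_funM.
  apply: le_trans (le_normr_Rintegral _ _) _ => //.
    exact: (leb_integrable01 m1 bsc).
  apply: le_Rintegral => //.
  - apply: (leb_integrable01 (B := C * r)); first exact: measurableT_comp.
    by move=> t; rewrite normr_id.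
  - apply: (leb_integrable01 (B := C * r)); first exact: measurable_funM.
    move=> t; rewrite normrM ger0_norm ?mulr_ge0 ?(ltW r0)// ler_piMr ?mulr_ge0 ?(ltW r0)//.
    by rewrite /ind indicE; case: (_ \in _); rewrite ?normr0 ?normr1.
  - move=> t _; rewrite /ind indicE mul1r.
    have [/set_mem _|tuv] := boolP (t \in _); first by rewrite mulr1; exact: hb.
    rewrite mulr0 normr_le0; apply/eqP/hs => /=.
    rewrite ltNge; apply: contra tuv => ht; rewrite inE/= in_itv/=.
    rewrite /u /v ler_pdivrMr// ler_pdivlMr// ![t * _]mulrC.
    by move: ht; rewrite ler_distl => /andP[? ?]; apply/andP; split; lra.
apply: (@le_trans _ _ ((C * r * (2 * B / 2 ^+ j)) * r)).
  rewrite ler_wpM2r ?(ltW r0)// (le_trans le1)// RintegralZl//.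
    by rewrite ler_wpM2l// mulr_ge0 ?(ltW r0).
  apply: (leb_integrable01 (B := 1)) => // t.
  by rewrite /ind indicE; case: (_ \in _); rewrite ?normr0 ?normr1.
rewrite -rr le_eqVlt; apply/orP; left; apply/eqP; field.
by rewrite gt_eqF.
Qed.

(** Polynomial reproduction in degree 0: the coefficients of the constant 1 are
    the means of the scaling functions, of order 2^(-j/2). *)
Lemma partition_of_one : (1 <= S)%N -> exists2 K : R, 0 <= K &
  forall j, (J0 <= j)%N -> exists a : 'I_(2 ^ j) -> R,
    (forall t, 0 <= t <= 1 -> \sum_m a m * scaling W m t = 1) /\
    (forall t, \sum_m `|a m * scaling W m t| <= K).
Proof.
move=> S1; have [K1 K10 h1] := scaling_mean_bound.
have [K2 K20 h2] := atom_sum_bound W.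
exists (K1 * K2); first by rewrite mulr_ge0.
move=> j jJ.
have [|a aE] := cdv_poly W (j := j) (q := 1) jJ; first by rewrite size_poly1.
exists a; split => [t t01|t]; first by rewrite -aE// hornerC.
have r0 : 0 < Num.sqrt (2 ^+ j) :> R by rewrite sqrtr_gt0 exprn_gt0.
have aI m : a m = inner01 (cst 1) (scaling W m).
  have msc m' : measurable_fun setT (scaling W (j := j) m').
    exact: (measurable_atom W (false, m')).
  have bsc m' : exists K : R, forall t, `|scaling W (j := j) m' t| <= K.
    exact: (atom_bounded W (false, m')).
  rewrite (inner01_suml (c := a) (e := fun m => scaling W m))//.
    rewrite (bigD1 m)//= big1 ?addr0.
      by rewrite cdv_scaling_on// eqxx mulr1.
    by move=> m' m'm; rewrite cdv_scaling_on// (negbTE m'm) mulr0.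
  by move=> t' t01; rewrite -aE// hornerC.
apply: (@le_trans _ _ (\sum_m K1 / Num.sqrt (2 ^+ j) * `|scaling W m t|)).
  apply: ler_sum => m _; rewrite normrM ler_wpM2r//.
  by rewrite ler_pdivlMr// aI; exact: h1.
rewrite -mulr_sumr -mulrA ler_wpM2l// mulrC ler_pdivrMr//.
exact: (h2 j false t jJ).
Qed.

(** Sampling b on the dyadic grid of mesh 2^(-j) and spreading the samples
    with the partition of unity only averages b over a shrinking window. *)
Lemma span_approx (b : space -> R) (e : R) : (1 <= S)%N -> 0 < e ->
  unif_continuous_cube b ->
  exists j0 : nat, forall j, (j0 <= j)%N -> (J0 <= j)%N ->
    exists c : loc d j -> R,
      forall x, cube x -> `|b x - \sum_m c m * Phi W m x| <= e.
Proof.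
move=> S1 e0 ub; have [K K0 hK] := partition_of_one S1.
have [B [C [B0 C0 H]]] := atom_shape W.
have Kd : 0 < K ^+ d + 1 by rewrite ltr_wpDl// exprn_ge0.
have [r r0 hr] := ub (e / (K ^+ d + 1)) (divr_gt0 e0 Kd).
exists (Num.truncn (B / r)).+1 => j jB jJ.
have [a [a1 aK]] := hK j jJ.
have p2 : 0 < 2 ^+ j :> R by rewrite exprn_gt0.
have Br : B / 2 ^+ j < r.
  rewrite ltr_pdivrMr// mulrC -ltr_pdivrMr//.
  apply: (lt_le_trans (truncnS_gt _)); rewrite -natrX ler_nat.
  by apply: leq_trans jB _; exact: ltnW (ltn_expl _ _).
pose node (m : loc d j) : space := [tuple (m i)%:R / 2 ^+ j | i < d].
have nodeE m i : tnth (node m) i = (m i)%:R / 2 ^+ j by rewrite tnth_mktuple.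
have nodec m : cube (node m).
  move=> i; rewrite nodeE divr_ge0 ?(ltW p2)//= ler_pdivrMr// mul1r -natrX ler_nat.
  exact: ltnW.
exists (fun m => b (node m) * \prod_i a (m i)) => x xc.
have prodE (m : loc d j) : (\prod_i a (m i)) * Phi W m x =
    \prod_i (a (m i) * scaling W (m i) (tnth x i)).
  by rewrite big_split.
have -> : b x - \sum_m b (node m) * (\prod_i a (m i)) * Phi W m x =
    \sum_m (b x - b (node m)) * \prod_i (a (m i) * scaling W (m i) (tnth x i)).
  under [RHS]eq_bigr do rewrite mulrBl.
  rewrite sumrB -mulr_sumr; congr (_ - _).
    rewrite (_ : \sum_m _ = 1) ?mulr1//.
    transitivity (\prod_(i < d) \sum_m a m * scaling W m (tnth x i)).
      by rewrite bigA_distr_bigA.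
    by rewrite big1// => i _; rewrite a1.
  by apply: eq_bigr => m _; rewrite -mulrA prodE.
apply: le_trans (ler_norm_sum _ _ _) _.
apply: (@le_trans _ _ (\sum_(m : loc d j) e / (K ^+ d + 1) *
    \prod_i `|a (m i) * scaling W (m i) (tnth x i)|)).
  apply: ler_sum => m _; rewrite normrM -normr_prod.
  have [z|nz] := eqVneq (\prod_i (a (m i) * scaling W (m i) (tnth x i))) 0.
    by rewrite z normr0 !mulr0.
  rewrite ler_wpM2r// ltW//; apply: hr => // i; rewrite nodeE.
  have [_ _ hs] := H j (false, m i) jJ.
  have near : `|2 ^+ j * tnth x i - (m i)%:R| <= B.
    rewrite leNgt; apply: contra nz => far.
    have z : scaling W (m i) (tnth x i) = 0 := hs _ far.
    by rewrite (bigD1 i)//= z mulr0 mul0r.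
  apply: le_lt_trans Br; rewrite ler_pdivlMr// -[X in _ * X]ger0_norm ?(ltW p2)//.
  by rewrite -normrM mulrBl divfK ?gt_eqF// mulrC.
rewrite -mulr_sumr.
have -> : \sum_(m : loc d j) \prod_i `|a (m i) * scaling W (m i) (tnth x i)| =
   \prod_(i < d) \sum_m `|a m * scaling W m (tnth x i)|.
  by rewrite bigA_distr_bigA.
rewrite -mulrA ler_piMr ?(ltW e0)// mulrC ler_pdivrMr// mul1r.
apply: (@le_trans _ _ (K ^+ d)); last by rewrite lerDl.
have -> : K ^+ d = \prod_(i < d) K by rewrite prodr_const card_ord.
by apply: ler_prod => i _; rewrite sumr_ge0/=.
Qed.

Lemma Phi_on j (m m' : loc d j) : (J0 <= j)%N ->
  \int[U]_x (Phi W m x * Phi W m' x) = (m == m')%:R.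
Proof.
move=> jJ; rewrite !PhiE.
have := tensor_on W [ffun i => (false, m i)] [ffun i => (false, m' i)] jJ.
rewrite innerE; [|exact: measurable_tensor..] => ->.
congr (nat_of_bool _)%:R; apply/eqP/eqP => [/ffunP h|->//].
by apply/ffunP => i; have := h i; rewrite !ffunE => -[].
Qed.

Lemma Phi_ess_bdd j (m : loc d j) : (J0 <= j)%N -> ess_bdd U (Phi W m).
Proof. by move=> jJ; rewrite PhiE; exact: tensor_ess_bdd. Qed.

Lemma inner_expect (f g : space -> R) : ess_bdd U f -> ess_bdd U g ->
  inner f g = \int[U]_x (f x * g x).
Proof. by move=> [mf _] [mg _]; exact: innerE. Qed.

Lemma innerC (f g : space -> R) : inner f g = inner g f.
Proof. by rewrite /inner; under eq_Rintegral do rewrite mulrC. Qed.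

Lemma innerBr (f g h : space -> R) : ess_bdd U f -> ess_bdd U g -> ess_bdd U h ->
  inner f (fun x => g x - h x) = inner f g - inner f h.
Proof.
move=> bf bg bh; rewrite !inner_expect//; last exact: ess_bddB.
rewrite -expectB; [|exact: ess_bddM..].
by apply: eq_Rintegral => x _; ring.
Qed.

Lemma innerBl (f g h : space -> R) : ess_bdd U f -> ess_bdd U g -> ess_bdd U h ->
  inner (fun x => g x - h x) f = inner g f - inner h f.
Proof. by move=> bf bg bh; rewrite innerC innerBr// !(innerC f). Qed.

Lemma resid_formBr j p b c : (J0 <= j)%N ->
  ess_bdd U p -> ess_bdd U b -> ess_bdd U c ->
  resid_form W j p (fun x => b x - c x) = resid_form W j p b - resid_form W j p c.
Proof.
move=> jJ bp bb bc; have bPhi m := Phi_ess_bdd (j := j) m jJ.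
rewrite /resid_form /proj_form innerBr//.
under eq_bigr => m _ do rewrite innerBl// mulrBr.
by rewrite sumrB; ring.
Qed.

Lemma resid_form_span j p (c : loc d j -> R) : (J0 <= j)%N -> ess_bdd U p ->
  resid_form W j p (fun x => \sum_m c m * Phi W m x) = 0.
Proof.
move=> jJ bp; have bPhi m := Phi_ess_bdd (j := j) m jJ.
rewrite /resid_form /proj_form (inner_sumr (c := c) (e := fun m => Phi W m))//.
apply/eqP; rewrite subr_eq0; apply/eqP; apply: eq_bigr => m _.
rewrite mulrC; congr (_ * _).
rewrite innerC (inner_sumr (c := c) (e := fun m => Phi W m))// (bigD1 m)//= big1 ?addr0.
  by rewrite inner_expect// Phi_on// eqxx mulr1.
by move=> m' m'm; rewrite inner_expect// Phi_on// eq_sym (negbTE m'm) mulr0.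
Qed.

(** The residual form is continuous for the L^2 norm: it is the difference of
    <p, w> and <Pi_j p, w>, and Pi_j does not increase norms. *)
Lemma resid_form_sqr_le j p w : (J0 <= j)%N -> ess_bdd U p -> ess_bdd U w ->
  resid_form W j p w ^+ 2 <= 4 * \int[U]_x (p x ^+ 2) * \int[U]_x (w x ^+ 2).
Proof.
move=> jJ bp bw; have bPhi m := Phi_ess_bdd (j := j) m jJ.
pose th (m : loc d j) := inner p (Phi W m).
pose q x := \sum_m th m * Phi W m x.
have bq : ess_bdd U q by apply: ess_bdd_sum => m; exact: ess_bddZ.
have -> : resid_form W j p w = \int[U]_x (p x * w x) - \int[U]_x (q x * w x).
  rewrite /resid_form inner_expect//; congr (_ - _).
  transitivity (\int[U]_x (\sum_m th m * (w x * Phi W m x))).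
    rewrite expect_sum; last by move=> m; apply: ess_bddZ; exact: ess_bddM.
    apply: eq_bigr => m _; rewrite expectZ; last exact: ess_bddM.
    by rewrite -inner_expect.
  by apply: eq_Rintegral => x _; rewrite mulr_suml; apply: eq_bigr => m _; ring.
have h1 := expect_CS bp bw; have h2 := expect_CS bq bw.
have h3 : \int[U]_x (q x ^+ 2) <= \int[U]_x (p x ^+ 2).
  rewrite /q (orthonormal_norm2 bPhi (fun m m' => Phi_on m m' jJ)).
  have := bessel bPhi (fun m m' => Phi_on m m' jJ) bp.
  by under eq_bigr do rewrite -inner_expect//.
have w0 : 0 <= \int[U]_x (w x ^+ 2) by apply: Rintegral_ge0 => x _; exact: sqr_ge0.
have h4 := le_trans h2 (ler_wpM2r w0 h3).
set a := \int[U]_x (p x * w x) in h1 *; set a' := \int[U]_x (q x * w x) in h4 *.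
rewrite -mulrA; set z := _ * _ in h1 h4 *.
have := sqr_ge0 (a + a'); nra.
Qed.

(** The form ignores elements of V_j in its second argument, and b is uniformly
    close to V_j for large j. *)
Lemma resid_form_small p b (e : R) : (1 <= S)%N -> 0 < e -> ess_bdd U p ->
  measurable_fun setT b -> unif_continuous_cube b ->
  exists j0 : nat, forall j, (j0 <= j)%N -> (J0 <= j)%N ->
    `|resid_form W j p b| <= e.
Proof.
move=> S1 e0 bp mb ub; have [B hB] := unif_continuous_bounded ub.
have bb : ess_bdd U b by exact: (cube_ess_bdd mb hB).
set P2 := \int[U]_x (p x ^+ 2).
have P0 : 0 <= P2 by apply: Rintegral_ge0 => x _; exact: sqr_ge0.
have P1 : 0 < 2 * (P2 + 1) by lra.
have [j0 hj] := span_approx S1 (divr_gt0 e0 P1) ub.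
exists j0 => j jj jJ; have [c hc] := hj j jj jJ.
have bv : ess_bdd U (fun x => \sum_m c m * Phi W m x).
  by apply: ess_bdd_sum => m; apply: ess_bddZ; exact: Phi_ess_bdd.
have -> : resid_form W j p b =
    resid_form W j p (fun x => b x - \sum_m c m * Phi W m x).
  by rewrite resid_formBr// resid_form_span// subr0.
have bw := ess_bddB bb bv.
have := resid_form_sqr_le jJ bp bw; rewrite -/P2.
have : \int[U]_x ((b x - \sum_m c m * Phi W m x) ^+ 2) <= (e / (2 * (P2 + 1))) ^+ 2.
  apply: norm2_le => //; apply: filterS (@cube_ae R d) => x xc; exact: hc.
set w2 := \int[U]_x _; set x := resid_form _ _ _ _; set t := e / _ => hw hx.
have te : e = t * (2 * (P2 + 1)) by rewrite /t divfK// gt_eqF.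
have t0 : 0 < t by exact: divr_gt0.
rewrite -(ler_pXn2r (n := 2))// ?nnegrE ?(ltW e0)// real_normK ?num_real//.
apply: le_trans hx _; apply: (@le_trans _ _ (4 * P2 * t ^+ 2)).
  by rewrite ler_wpM2l// mulr_ge0.
rewrite te; have := sqr_ge0 t; nra.
Qed.

(** Telescoping from level j to a level where the residual is negligible leaves
    a geometric sum of ratio 2^(-(al + be)). *)
Lemma resid_form_le al be M (p b : space -> R) j : (1 <= S)%N -> 0 < al + be -> (J0 <= j)%N ->
  measurable_fun setT p -> measurable_fun setT b ->
  holder_ball W al M p -> holder_ball W be M b ->
  `|resid_form W j p b| <=
    2 ^+ d * M ^+ 2 / (1 - 2 `^ (- (al + be))) * (2 `^ (- (al + be))) ^+ j.
Proof.
move=> S1 ab0 jJ mp mb hp hb.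
have [Bp hBp] := unif_continuous_bounded hp.1.
have [Bb hBb] := unif_continuous_bounded hb.1.
have bp : ess_bdd U p := cube_ess_bdd mp hBp.
have bb : ess_bdd U b := cube_ess_bdd mb hBb.
set rho := 2 `^ (- (al + be)).
have rho0 : 0 < rho by exact: powR_gt0.
have rho1 : 0 < 1 - rho.
  rewrite subr_gt0 /rho powRN invf_lt1 ?powR_gt0//.
  have := gt0_ltr_powR ab0 (x := 1) (y := 2).
  by rewrite powR1 !nnegrE; apply; rewrite ?ltr1n.
set D := 2 ^+ d * M ^+ 2.
have D0 : 0 <= D by rewrite mulr_ge0 ?sqr_ge0// exprn_ge0.
have tele n : `|proj_form W (j + n) p b - proj_form W j p b| <=
    D / (1 - rho) * (rho ^+ j - rho ^+ (j + n)).
  elim: n => [|n IH]; first by rewrite addn0 !subrr normr0 mulr0.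
  have step := proj_form_detail (leq_trans jJ (leq_addr n j)) bp bb hp hb.
  rewrite addnS; have := ler_normD (proj_form W (j + n).+1 p b - proj_form W (j + n) p b)
    (proj_form W (j + n) p b - proj_form W j p b).
  rewrite addrA subrK => /le_trans; apply; apply: le_trans (lerD step IH) _.
  rewrite -/rho -/D exprS le_eqVlt; apply/orP; left; apply/eqP; field.
  by rewrite gt_eqF.
apply/ler_addgt0Pl => e e0.
have [j0 hj] := resid_form_small S1 e0 bp mb hb.1.
have h1 := hj (j + j0)%N (leq_addl _ _) (leq_trans jJ (leq_addr _ _)).
have h2 := tele j0.
have -> : resid_form W j p b = resid_form W (j + j0) p b +
    (proj_form W (j + j0) p b - proj_form W j p b) by rewrite /resid_form; ring.
rewrite (le_trans (ler_normD _ _))// lerD// (le_trans h2)// ler_wpM2l//.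
  by rewrite divr_ge0// ltW.
by rewrite gerBl exprn_ge0// ltW.
Qed.

End approximation.

(** * Mean squared error over the model *)

Section model_mse.
Variables (R : realType) (S J0 : nat) (W : cdv_basis R S J0) (d : nat).
Notation space := (Defs.point R d).
Notation U := (unif_cube R d).
Notation obs := (obs R d).

Lemma measurable_obsX : measurable_fun [set: obs] (@obsX R d).
Proof. by apply: (measurableT_comp measurable_fst); exact: measurable_fst. Qed.

Lemma measurable_obsA : measurable_fun [set: obs] (@obsA R d).
Proof. by apply: (measurableT_comp measurable_snd); exact: measurable_fst. Qed.

Lemma measurable_obsY : measurable_fun [set: obs] (@obsY R d).
Proof. exact: measurable_snd. Qed.

Variables (P : probability obs R) (B : R) (p b : space -> R).
Hypotheses (XP : has_law P U (@obsX R d))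
  (AB : {ae P, forall z, `|obsA z| <= B}) (YB : {ae P, forall z, `|obsY z| <= B})
  (pA : is_cond_exp P (@obsX R d) (@obsA R d) p)
  (bY : is_cond_exp P (@obsX R d) (@obsY R d) b)
  (bp : ess_bdd U p) (bb : ess_bdd U b).

Let bA : ess_bdd P (@obsA R d).
Proof. by split; [exact: measurable_obsA|exists B]. Qed.

Let bY' : ess_bdd P (@obsY R d).
Proof. by split; [exact: measurable_obsY|exists B]. Qed.

Let f j (m : loc d j) (z : obs) := Phi W m (obsX z).

Let bf j m : (J0 <= j)%N -> ess_bdd P (f (j := j) m).
Proof.
by move=> jJ; apply: (law_ess_bdd measurable_obsX XP); exact: Phi_ess_bdd.
Qed.

Let expectX g h : ess_bdd U g -> ess_bdd U h ->
  \int[P]_z (g (obsX z) * h (obsX z)) = inner g h.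
Proof.
move=> bg bh; rewrite inner_expect//.
have bgh := ess_bddM bg bh.
rewrite (law_expect measurable_obsX XP)//; first exact: ess_bdd_mfun bgh.
exact: (law_ess_bdd measurable_obsX XP).
Qed.

Let f_on j (m m' : loc d j) : (J0 <= j)%N ->
  \int[P]_z (f m z * f m' z) = (m == m')%:R.
Proof.
move=> jJ; rewrite /f expectX; [|exact: Phi_ess_bdd..].
by rewrite inner_expect; [exact: Phi_on|exact: Phi_ess_bdd..].
Qed.

Let tower_Phi V v j (m : loc d j) : (J0 <= j)%N -> ess_bdd P V ->
  is_cond_exp P (@obsX R d) V v -> ess_bdd U v ->
  \int[P]_z (V z * f m z) = inner v (Phi W m).
Proof.
move=> jJ bV vV bv; have bPhi := Phi_ess_bdd W m jJ.
rewrite -expectX// -(tower measurable_obsX bV _ vV)//.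
- exact: (law_ess_bdd measurable_obsX XP).
- exact: ess_bdd_mfun bPhi.
- exact: (law_ess_bdd measurable_obsX XP).
Qed.

(** By the tower property A and Y may be replaced by p(X) and b(X) in every
    coefficient, and the law of X turns expectations into inner products. *)
Lemma split_bias_resid j : (J0 <= j)%N ->
  split_bias P (@obsA R d) (@obsY R d) (f (j := j)) (psi P) = resid_form W j p b.
Proof.
move=> jJ; rewrite /split_bias /psi (expect_cond_cov measurable_obsX XP bA bY' pA bY).
- rewrite expectX// /resid_form /proj_form.
  under eq_bigr => m _ do
    rewrite (tower_Phi m jJ bA pA bp) (tower_Phi m jJ bY' bY bb).
  ring.
- exact: (law_ess_bdd measurable_obsX XP).
- exact: (law_ess_bdd measurable_obsX XP).
Qed.

Lemma mse_ge_resid j n : (J0 <= j)%N -> (0 < n)%N ->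
  ((resid_form W j p b ^+ 2)%:E <= mse W j n P)%E.
Proof.
move=> jJ n0; rewrite -split_bias_resid//.
exact: (split_mse_ge_bias bA bY' (fun m => bf m jJ)).
Qed.

Lemma mse_le_resid j n : (J0 <= j)%N -> (0 < n)%N ->
  (mse W j n P <= (resid_form W j p b ^+ 2 +
     5 * B ^+ 4 / n%:R + 2 * B ^+ 4 * 2 ^+ (j * d) / n%:R ^+ 2)%:E)%E.
Proof.
move=> jJ n0; rewrite -split_bias_resid//.
have -> : 2 ^+ (j * d) = #|loc d j|%:R :> R.
  by rewrite card_ffun !card_ord -expnM natrX.
exact: (split_mse_le bA bY' (fun m => bf m jJ) (fun m m' => f_on m m' jJ) AB YB).
Qed.

End model_mse.

(** * Uniform continuity on the cube *)

Section uniform_continuity.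
Variables (R : realType) (d : nat).
Notation space := (Defs.point R d).

(** Heine's theorem: near each point of the compact segment continuity gives a
    modulus valid for all sufficiently small r. *)
Lemma segment_unif_continuous (f : R -> R) (e : R) : continuous f -> 0 < e ->
  exists2 r : R, 0 < r & forall s t, 0 <= s <= 1 -> 0 <= t <= 1 ->
    `|s - t| < r -> `|f s - f t| < e.
Proof.
move=> cf e0; pose Q (r s : R) := forall t, `|s - t| < r -> `|f s - f t| < e.
have /compact_near_coveringP cov := @segment_compact R 0 1.
have : \forall r \near 0^'+, `[0, 1] `<=` Q r.
  apply: (cov R (0^'+) Q) => x _.
  have /cvgrPdist_lt/(_ (e / 2)) : f z @[z --> x] --> f x by exact: cf.
  move=> /(_ (divr_gt0 e0 (ltr0Sn _ 1))) [dl /= dl0 hd].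
  exists ([set z | `|x - z| < dl / 2], [set r | r < dl / 2]) => /=.
    split; last exact: nbhs_right_lt (divr_gt0 dl0 (ltr0Sn _ 1)).
    by exists (dl / 2) => /=; [exact: divr_gt0|].
  move=> [z r] /= [xz rd] t zt.
  have h1 : `|f x - f z| < e / 2.
    by apply: hd => /=; rewrite (lt_le_trans xz)// ler_pdivrMr// ler_peMr ?(ltW dl0)// ler1n.
  have h2 : `|f x - f t| < e / 2.
    apply: hd => /=; have := ler_normD (x - z) (z - t).
    by rewrite addrA subrK; lra.
  have := ler_normB (f x - f t) (f x - f z).
  have -> : f x - f t - (f x - f z) = f z - f t by ring.
  lra.
move=> near0; have := nbhs_right_gt (0 : R) => pos.
have [r [hr r0]] : exists r, (`[0, 1] `<=` Q r) /\ 0 < r.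
  by near (0 : R)^'+ => r; exists r; split; near: r.
exists r => // s t s01 t01; apply: hr; by rewrite /= in_itv.
Unshelve. all: by end_near. Qed.

Lemma uc_cst c : unif_continuous_cube (fun _ : space => c).
Proof. by move=> e e0; exists 1 => // x y _ _ _; rewrite subrr normr0. Qed.

Lemma uc_coord (f : R -> R) i : continuous f ->
  unif_continuous_cube (fun x : space => f (tnth x i)).
Proof.
move=> cf e e0; have [r r0 hr] := segment_unif_continuous cf e0.
by exists r => // x y xc yc xy; apply: hr.
Qed.

Lemma uc_add (f g : space -> R) : unif_continuous_cube f ->
  unif_continuous_cube g -> unif_continuous_cube (fun x => f x + g x).
Proof.
move=> uf ug e e0; have e20 : 0 < e / 2 by exact: divr_gt0.
have [r r0 hr] := uf _ e20; have [r' r'0 hr'] := ug _ e20.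
exists (Num.min r r'); first by rewrite lt_min r0.
move=> x y xc yc xy.
have h1 : `|f x - f y| < e / 2.
  by apply: hr => // i; have := xy i; rewrite lt_min => /andP[].
have h2 : `|g x - g y| < e / 2.
  by apply: hr' => // i; have := xy i; rewrite lt_min => /andP[].
have -> : f x + g x - (f y + g y) = (f x - f y) + (g x - g y) by ring.
by have := ler_normD (f x - f y) (g x - g y); lra.
Qed.

Lemma uc_mul (f g : space -> R) : unif_continuous_cube f ->
  unif_continuous_cube g -> unif_continuous_cube (fun x => f x * g x).
Proof.
move=> uf ug e e0.
have [A hA] := unif_continuous_bounded uf; have [B hB] := unif_continuous_bounded ug.
pose K := `|A| + `|B| + 1.
have K0 : 0 < K by rewrite ltr_wpDl// addr_ge0.
have eK : 0 < e / (2 * K) by rewrite divr_gt0// mulr_gt0.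
have [r r0 hr] := uf _ eK; have [r' r'0 hr'] := ug _ eK.
exists (Num.min r r'); first by rewrite lt_min r0.
move=> x y xc yc xy.
have h1 : `|f x - f y| < e / (2 * K).
  by apply: hr => // i; have := xy i; rewrite lt_min => /andP[].
have h2 : `|g x - g y| < e / (2 * K).
  by apply: hr' => // i; have := xy i; rewrite lt_min => /andP[].
have -> : f x * g x - f y * g y = f x * (g x - g y) + (f x - f y) * g y by ring.
apply: le_lt_trans (ler_normD _ _) _; rewrite !normrM.
have -> : e = K * (e / (2 * K)) + e / (2 * K) * K by field; rewrite gt_eqF.
have fK : `|f x| <= K.
  by have := hA x xc; have := ler_norm A; have := normr_ge0 B; rewrite /K; lra.
have gK : `|g y| <= K.
  by have := hB y yc; have := ler_norm B; have := normr_ge0 A; rewrite /K; lra.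
apply: ltr_leD.
  apply: (@le_lt_trans _ _ (K * `|g x - g y|)); first by rewrite ler_wpM2r.
  by rewrite ltr_pM2l.
by apply: ler_pM => //; exact: ltW.
Qed.

Lemma uc_sum (I : Type) (s : seq I) (F : I -> space -> R) :
  (forall i, unif_continuous_cube (F i)) ->
  unif_continuous_cube (fun x => \sum_(i <- s) F i x).
Proof.
move=> uF; elim: s => [|i s IH].
  by under eq_fun do rewrite big_nil; exact: uc_cst.
by under eq_fun do rewrite big_cons; exact: uc_add.
Qed.

Lemma uc_prod (I : Type) (s : seq I) (F : I -> space -> R) :
  (forall i, unif_continuous_cube (F i)) ->
  unif_continuous_cube (fun x => \prod_(i <- s) F i x).
Proof.
move=> uF; elim: s => [|i s IH].
  by under eq_fun do rewrite big_nil; exact: uc_cst.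
by under eq_fun do rewrite big_cons; exact: uc_mul.
Qed.

End uniform_continuity.

(** * A sum of wavelets of one level *)

Section wave_sum.
Variables (R : realType) (S J0 : nat) (W : cdv_basis R S J0) (d : nat).
Notation space := (Defs.point R d).
Notation U := (unif_cube R d).

Lemma tensor_uc j (s : {ffun 'I_d -> bool * 'I_(2 ^ j)}) : (J0 <= j)%N ->
  unif_continuous_cube (tensor W s).
Proof.
move=> jJ; apply: uc_prod => i; apply: uc_coord.
by have [B [C [_ _ /(_ _ (s i) jJ)[]]]] := atom_shape W.
Qed.

(** Only the wavelets whose d factors are all one-dimensional wavelets: their sum
    is the d-fold tensor power of the sum of the one-dimensional wavelets. *)
Definition wave_sum j (x : space) : R :=
  \sum_(m : loc d j) Psi W [ffun=> true] m x.

Lemma measurable_wave_sum j : (J0 <= j)%N -> measurable_fun setT (wave_sum j).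
Proof.
by move=> jJ; apply: measurable_sum => m; rewrite PsiE; exact: measurable_tensor.
Qed.

Lemma wave_sum_uc j : (J0 <= j)%N -> unif_continuous_cube (wave_sum j).
Proof. by move=> jJ; apply: uc_sum => m; rewrite PsiE; exact: tensor_uc. Qed.

Lemma Psi_ess_bdd j iota (m : loc d j) : (J0 <= j)%N -> ess_bdd U (Psi W iota m).
Proof. by move=> jJ; rewrite PsiE; exact: tensor_ess_bdd. Qed.

Lemma wave_sum_ess_bdd j : (J0 <= j)%N -> ess_bdd U (wave_sum j).
Proof. by move=> jJ; apply: ess_bdd_sum => m; exact: Psi_ess_bdd. Qed.

(** Since the wavelets of a level overlap boundedly often, their sum is no larger
    in order than each of them. *)
Lemma wave_sum_bound : exists2 K : R, 0 <= K & forall j x, (J0 <= j)%N ->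
  `|wave_sum j x| <= K * 2 `^ (j%:R * (d%:R / 2)).
Proof.
have [K K0 hK] := atom_sum_bound W; exists (K ^+ d); first exact: exprn_ge0.
move=> j x jJ; rewrite /wave_sum (le_trans (ler_norm_sum _ _ _))//.
have -> : \sum_(m : loc d j) `|Psi W [ffun=> true] m x| =
    \prod_(i < d) \sum_(m < 2 ^ j) `|atom W (true, m) (tnth x i)|.
  rewrite bigA_distr_bigA; apply: eq_bigr => m _.
  by rewrite PsiE normr_prod; apply: eq_bigr => i _; rewrite !ffunE.
apply: (@le_trans _ _ (\prod_(i < d) (K * Num.sqrt (2 ^+ j)))).
  by apply: ler_prod => i _; rewrite sumr_ge0//= hK.
rewrite prodr_const card_ord exprMn; apply: ler_wpM2l; first exact: exprn_ge0.
rewrite -powR12_sqrt ?exprn_ge0// -powR_mulrn// -!powRrM -powR_mulrn ?powR_ge0//.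
by rewrite -powRrM le_eqVlt; apply/orP; left; apply/eqP; congr (_ `^ _); ring.
Qed.

Lemma inner_wave_sumr j p : (J0 <= j)%N -> ess_bdd U p ->
  inner p (wave_sum j) = \sum_(m : loc d j) inner p (Psi W [ffun=> true] m).
Proof.
move=> jJ bp.
rewrite (inner_sumr (c := fun=> 1) (e := fun m : loc d j => Psi W [ffun=> true] m))//.
- by under eq_bigr do rewrite mul1r.
- by move=> m; exact: Psi_ess_bdd.
- by move=> x _; apply: eq_bigr => m _; rewrite mul1r.
Qed.

Lemma inner_wave_sum j l (iota : {ffun 'I_d -> bool}) (m' : loc d l) :
  (J0 <= j)%N -> (J0 <= l)%N ->
  inner (Psi W iota m') (wave_sum j) =
  \sum_(m : loc d j) \prod_(i < d)
     inner01 (atom W (iota i, m' i)) (wavelet W (m i)).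
Proof.
move=> jJ lJ.
rewrite inner_wave_sumr//; last exact: Psi_ess_bdd.
apply: eq_bigr => m _; rewrite !PsiE.
rewrite (inner_prod (f := fun i => atom W ([ffun i => (iota i, m' i)] i))
  (g := fun i => atom W ([ffun i => ([ffun=> true] i, m i)] i))).
- by apply: eq_bigr => i _; rewrite !ffunE.
- by move=> i; exact: measurable_atom.
- by move=> i; exact: measurable_atom.
- by move=> i; exact: atom_bounded.
- by move=> i; exact: atom_bounded.
Qed.

(** By orthonormality the coefficient is 1 on the terms of the sum and 0 on all
    other wavelets. *)
Lemma inner_wave_sum_Psi j l (iota : {ffun 'I_d -> bool}) (m' : loc d l) :
  (J0 <= j)%N -> (J0 <= l)%N -> iota != [ffun=> false] ->
  `|inner (wave_sum j) (Psi W iota m')| <= (j == l)%:R.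
Proof.
move=> jJ lJ iota0; rewrite innerC inner_wave_sum//.
have [i0 hi0] : exists i, iota i = true.
  apply/not_existsP => h; move/eqP: iota0; apply; apply/ffunP => i.
  by rewrite ffunE; apply/negP => ?; apply: (h i).
have [jl|jl] := eqVneq j l; last first.
  rewrite big1 ?normr0// => m _; rewrite (bigD1 i0)//= /atom/= hi0.
  by rewrite cdv_wavelet_on// eq_sym (negbTE jl) mul0r.
subst l.
have E (m : loc d j) : \prod_(i < d) inner01 (atom W (iota i, m' i)) (wavelet W (m i)) =
    (iota == [ffun=> true])%:R * (m' == m)%:R :> R.
  transitivity (\prod_(i < d) (((iota i, m' i) == (true, m i))%:R : R)).
    apply: eq_bigr => i _; rewrite -(atom_on W _ _ jJ); first by [].
  have [it|/eqP it] := eqVneq iota [ffun=> true]; last first.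
    have [i /eqP hi] : exists i, iota i <> true.
      by apply/existsNP => h; apply: it; apply/ffunP => i; rewrite ffunE.
    by rewrite (bigD1 i)//= xpair_eqE (negbTE hi) !mul0r.
  have [->|/eqP mm] := eqVneq m' m.
    by rewrite big1 ?mulr1// => i _; rewrite it ffunE eqxx.
  have [i /eqP hi] : exists i, m' i <> m i.
    by apply/existsNP => h; apply: mm; apply/ffunP.
  by rewrite (bigD1 i)//= xpair_eqE (negbTE hi) andbF mul0r mulr0.
under eq_bigr do rewrite E.
rewrite -mulr_sumr (bigD1 m')//= big1 ?eqxx ?addr0 ?mulr1.
  by case: (iota == _); rewrite ?normr0 ?normr1 ?ler01.
by move=> m mm; rewrite eq_sym (negbTE mm).
Qed.

(** Coarser scaling functions lie in V_j, which is orthogonal to the wavelets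
    of level j. *)
Lemma scaling_wavelet_orth j l (m' : 'I_(2 ^ l)) (m : 'I_(2 ^ j)) :
  (J0 <= l)%N -> (l <= j)%N -> inner01 (scaling W m') (wavelet W m) = 0.
Proof.
move=> lJ lj; have [k jE] : exists k, j = (l + k)%N by exists (j - l)%N; lia.
subst j; elim: k l lJ lj m' m => [|k IH] l lJ lj m' m.
  by move: m; rewrite addn0 => m; exact: cdv_scaling_wavelet.
have [c cE] := cdv_scaling_up W m' lJ.
have lJ' : (J0 <= l.+1)%N by rewrite ltnW.
have jJ : (J0 <= l + k.+1)%N by rewrite (leq_trans lJ)// leq_addr.
rewrite (inner01_suml (c := c) (e := fun m => scaling W m))//.
- rewrite big1// => m1 _; move: m; rewrite addnS -addSn => m.
  by rewrite IH ?mulr0// leq_addr.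
- by move=> i; exact: (measurable_atom W (false, i)).
- by move=> i; exact: (atom_bounded W (false, i)).
- exact: (measurable_atom W (true, m)).
- exact: (atom_bounded W (true, m)).
Qed.

Hypothesis d_gt0 : (0 < d)%N.

Lemma inner_wave_sum_Phi j l (m' : loc d l) : (J0 <= l)%N -> (l <= j)%N ->
  inner (wave_sum j) (Phi W m') = 0.
Proof.
move=> lJ lj; have jJ := leq_trans lJ lj.
have -> : Phi W m' = Psi W [ffun=> false] m'.
  by rewrite PhiE PsiE; congr tensor; apply/ffunP => i; rewrite !ffunE.
rewrite innerC inner_wave_sum// big1// => m _.
rewrite (bigD1 (Ordinal d_gt0))//= ffunE /atom/=.
by rewrite scaling_wavelet_orth// mul0r.
Qed.

Lemma inner_wave_sum_wave_sum j : (J0 <= j)%N -> inner (wave_sum j) (wave_sum j) = 2 ^+ (j * d).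
Proof.
move=> jJ.
rewrite inner_wave_sumr//; last exact: wave_sum_ess_bdd.
under eq_bigr => m _.
  rewrite innerC inner_wave_sumr//; last exact: Psi_ess_bdd.
  rewrite (bigD1 m)//= big1 => [|m1 m1m]; last first.
    rewrite !PsiE tensor_on//; case: eqP => // /ffunP h.
    case/eqP: m1m; apply/ffunP => i; have := h i; rewrite !ffunE.
    by move=> [].
  rewrite !PsiE tensor_on// eqxx addr0.
  over.
by rewrite sumr_const card_ffun !card_ord -expnM natrX.
Qed.

Lemma resid_wave_sum j : (J0 <= j)%N -> resid_form W j (wave_sum j) (wave_sum j) = 2 ^+ (j * d).
Proof.
move=> jJ; rewrite /resid_form /proj_form inner_wave_sum_wave_sum// big1 ?subr0// => m _.
by rewrite inner_wave_sum_Phi// mul0r.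
Qed.

(** Constants belong to V_l, which is orthogonal to the wavelets of level l. *)
Lemma inner_cst_Psi c l (iota : {ffun 'I_d -> bool}) (m : loc d l) :
  (1 <= S)%N -> (J0 <= l)%N -> iota != [ffun=> false] ->
  inner (cst c) (Psi W iota m) = 0.
Proof.
move=> S1 lJ iota0.
have [i0 hi0] : exists i, iota i = true.
  apply/not_existsP => h; move/eqP: iota0; apply; apply/ffunP => i.
  by rewrite ffunE; apply/negP => ?; apply: (h i).
have w0 : inner01 (cst 1) (wavelet W (m i0)) = 0.
  have [|a aE] := cdv_poly W (j := l) (q := 1) lJ; first by rewrite size_poly1.
  rewrite (inner01_suml (c := a) (e := fun m => scaling W m))//.
  - by rewrite big1// => m1 _; rewrite cdv_scaling_wavelet// mulr0.
  - by move=> i; exact: (measurable_atom W (false, i)).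
  - by move=> i; exact: (atom_bounded W (false, i)).
  - exact: (measurable_atom W (true, m i0)).
  - exact: (atom_bounded W (true, m i0)).
  - by move=> t t01; rewrite -aE// hornerC.
rewrite innerC (inner_sumr (I := 'I_1) (c := fun=> c)
  (e := fun _ x => \prod_(i < d) (cst 1 (tnth x i) : R))).
- rewrite big1// => _ _; rewrite innerC PsiE.
  rewrite (inner_prod (f := fun=> cst 1) (g := fun i => atom W ([ffun i => (iota i, m i)] i)))//.
  + rewrite (bigD1 i0)//= ffunE /atom/= hi0 w0 mul0r mulr0//.
  + by move=> i; exact: measurable_atom.
  + by move=> i; exists 1 => t; rewrite normr1.
  + by move=> i; exact: atom_bounded.
- exact: Psi_ess_bdd.
- move=> _; under eq_fun do rewrite big1//; exact: ess_bdd_cst.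
- by move=> x _; rewrite big_ord1 big1// mulr1.
Qed.

End wave_sum.

(** * Perturbing a distribution of the model *)

Section perturbation.
Variables (R : realType) (d : nat).
Notation space := (Defs.point R d).
Notation U := (unif_cube R d).
Notation obs := (obs R d).

(** Shrinking A and Y towards the midpoint c of their range by the factor 1 - t
    frees a margin of width t (C2 - C1) / 2 at both ends, into which the
    perturbations phi and chi of the two regressions fit. *)
Definition shift_obs (t c : R) (phi chi : space -> R) (z : obs) : obs :=
  (obsX z, (1 - t) * obsA z + t * c + phi (obsX z),
   (1 - t) * obsY z + t * c + chi (obsX z)).

Variables (P0 : probability obs R) (C1 C2 t : R) (phi chi : space -> R).
Hypotheses (t01 : 0 <= t <= 1) (mphi : measurable_fun setT phi)
  (mchi : measurable_fun setT chi).

Let c := (C1 + C2) / 2.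
Let T := shift_obs t c phi chi.

Lemma measurable_shift_obs : measurable_fun setT T.
Proof.
have mX := @measurable_obsX R d; have mA := @measurable_obsA R d.
have mY := @measurable_obsY R d.
apply: measurable_fun_pair; first apply: measurable_fun_pair => //.
  apply: measurable_funD; last exact: (measurableT_comp mphi mX).
  by apply: measurable_funD => //; exact: measurable_funM.
apply: measurable_funD; last exact: (measurableT_comp mchi mX).
by apply: measurable_funD => //; exact: measurable_funM.
Qed.

Definition shift_mfun : {mfun obs >-> obs} :=
  HB.pack T (isMeasurableFun.Build _ _ _ _ T measurable_shift_obs).

Definition shift_prob : probability obs R := distribution P0 shift_mfun.

Hypothesis XP0 : has_law P0 U (@obsX R d).

Lemma shift_law : has_law P0 shift_prob T.
Proof. by []. Qed.

Lemma shift_obsX_law : has_law shift_prob U (@obsX R d).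
Proof. exact: XP0. Qed.

Lemma shift_cond_exp (V : obs -> R) (f : space -> R) (g : space -> R) :
  measurable_fun setT V -> ess_bdd P0 V -> ess_bdd U f -> ess_bdd U g ->
  (forall z, V (T z) = (1 - t) * V z + t * c + g (obsX z)) ->
  is_cond_exp P0 (@obsX R d) V f ->
  is_cond_exp shift_prob (@obsX R d) V (fun x => (1 - t) * f x + t * c + g x).
Proof.
move=> mV bV bf bg VT [mf intf fE].
have mX := @measurable_obsX R d.
have bh : ess_bdd U (fun x => (1 - t) * f x + t * c + g x).
  by apply: ess_bddD => //; apply: ess_bddD; [exact: ess_bddZ|exact: ess_bdd_cst].
have bhX : ess_bdd P0 (fun z => (1 - t) * f (obsX z) + t * c + g (obsX z)).
  exact: (law_ess_bdd mX XP0 bh).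
have bhX' : ess_bdd shift_prob (fun z => (1 - t) * f (obsX z) + t * c + g (obsX z)).
  exact: (law_ess_bdd mX shift_obsX_law bh).
split; [exact: ess_bdd_mfun bh|exact: ess_bdd_int bhX'|] => B mB.
have mXB := measurable_preimage mX mB.
have bVT : ess_bdd P0 (fun z => (1 - t) * V z + t * c + g (obsX z)).
  apply: ess_bddD; last exact: (law_ess_bdd mX XP0 bg).
  by apply: ess_bddD; [exact: ess_bddZ|exact: ess_bdd_cst].
rewrite (law_integral measurable_shift_obs shift_law mXB); last 2 first.
- by apply/measurable_EFinP; exact: ess_bdd_mfun bhX'.
- exact: ess_bdd_int bhX.
rewrite (law_integral measurable_shift_obs shift_law mXB); last 2 first.
- exact/measurable_EFinP.
- rewrite (_ : _ \o _ = EFin \o (fun z => (1 - t) * V z + t * c + g (obsX z))).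
    exact: ess_bdd_int bVT.
  by apply/funext => z /=; rewrite VT.
rewrite (_ : T @^-1` (@obsX R d @^-1` B) = @obsX R d @^-1` B)//.
have br : ess_bdd P0 (fun z => t * c + g (obsX z)).
  by apply: ess_bddD; [exact: ess_bdd_cst|exact: (law_ess_bdd mX XP0 bg)].
have split_int (v : obs -> R) : ess_bdd P0 v ->
    (\int[P0]_(w in @obsX R d @^-1` B) ((1 - t) * v w + t * c + g (obsX w))%:E =
     (1 - t)%:E * \int[P0]_(w in @obsX R d @^-1` B) (v w)%:E +
     \int[P0]_(w in @obsX R d @^-1` B) (t * c + g (obsX w))%:E)%E.
  move=> bv; rewrite -integralZl//; last by apply: integrableS (ess_bdd_int bv).
  rewrite -integralD//.
  - by apply: eq_integral => w _; rewrite -EFinM -EFinD addrA.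
  - by apply: integrableS (ess_bdd_int (ess_bddZ (1 - t) bv)).
  - by apply: integrableS (ess_bdd_int br).
transitivity (\int[P0]_(w in @obsX R d @^-1` B) ((1 - t) * f (obsX w) + t * c + g (obsX w))%:E)%E.
  by [].
rewrite (split_int (fun z => f (obsX z))); last exact: (law_ess_bdd mX XP0).
by rewrite fE// -split_int//; apply: eq_integral => w _; rewrite VT.
Qed.

Lemma shift_range (V : obs -> R) (g : space -> R) : measurable_fun setT V ->
  (forall x, cube x -> `|g x| <= t * ((C2 - C1) / 2)) ->
  (forall z, V (T z) = (1 - t) * V z + t * c + g (obsX z)) ->
  {ae P0, forall z, C1 <= V z <= C2} -> {ae shift_prob, forall z, C1 <= V z <= C2}.
Proof.
move=> mV gb VT VC.
apply: (law_ae_inv measurable_shift_obs shift_law).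
  rewrite (_ : [set z | _] = V @^-1` `[C1, C2]); last first.
    by apply/seteqP; split => z /=; rewrite in_itv.
  by rewrite -[X in measurable X]setTI; apply: mV.
have XC := law_ae (@measurable_obsX R d) XP0 (@cube_ae R d).
apply: filterS2 VC XC => z /andP[z1 z2] /gb; rewrite ler_norml => /andP[g1 g2].
move/andP: t01 => [t0 t1].
have h1 : (1 - t) * C1 <= (1 - t) * V z by rewrite ler_wpM2l// subr_ge0.
have h2 : (1 - t) * V z <= (1 - t) * C2 by rewrite ler_wpM2l// subr_ge0.
by rewrite VT /c; apply/andP; split; lra.
Qed.

End perturbation.

(** * Lower bound on the bias *)

Section lower_bound.
Variables (R : realType) (S J0 : nat) (W : cdv_basis R S J0) (d : nat).
Notation space := (Defs.point R d).
Notation U := (unif_cube R d).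
Hypotheses (d_gt0 : (0 < d)%N) (S1 : (1 <= S)%N).

Lemma resid_formC j (p b : space -> R) : resid_form W j p b = resid_form W j b p.
Proof.
rewrite /resid_form /proj_form innerC; congr (_ - _).
by apply: eq_bigr => m _; rewrite mulrC.
Qed.

Lemma inner_lin (h p q : space -> R) u : ess_bdd U h -> ess_bdd U p -> ess_bdd U q ->
  inner (fun x => p x + u * q x) h = inner p h + u * inner q h.
Proof.
move=> bh bp bq; rewrite !inner_expect//; last by apply: ess_bddD => //; exact: ess_bddZ.
rewrite -expectZ; last exact: ess_bddM.
rewrite -expectD; [|exact: ess_bddM|by apply: ess_bddZ; exact: ess_bddM].
by apply: eq_Rintegral => x _; ring.
Qed.

Lemma resid_form_lin j p q b u : (J0 <= j)%N ->
  ess_bdd U p -> ess_bdd U q -> ess_bdd U b ->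
  resid_form W j (fun x => p x + u * q x) b =
  resid_form W j p b + u * resid_form W j q b.
Proof.
move=> jJ bp bq bb; have bPhi m := Phi_ess_bdd (j := j) W m jJ.
rewrite /resid_form /proj_form inner_lin//.
under eq_bigr => m _ do rewrite inner_lin// mulrDl -mulrA.
by rewrite big_split/= -mulr_sumr; ring.
Qed.

Lemma coarse_norm_ge0 a (h : space -> R) : 0 <= coarse_norm W a h.
Proof. by rewrite mulr_ge0 ?powR_ge0//; exact: bigmax_ge_id. Qed.

(** At the scale allowed by a Hoelder ball the perturbation is bounded uniformly
    in the level. *)
Lemma wave_sum_ball_range a (e : R) (K : R) j (x : space) : 0 < a -> 0 <= e -> 0 <= K ->
  `|wave_sum W j x| <= K * 2 `^ (j%:R * (d%:R / 2)) ->
  `|e * 2 `^ (- (j%:R * (a + d%:R / 2))) * wave_sum W j x| <= e * K.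
Proof.
move=> a0 e0 K0 hb; rewrite normrM ger0_norm ?mulr_ge0 ?powR_ge0//.
rewrite -mulrA ler_wpM2l//.
apply: (@le_trans _ _ (2 `^ (- (j%:R * (a + d%:R / 2))) *
   (K * 2 `^ (j%:R * (d%:R / 2))))); first by rewrite ler_wpM2l ?powR_ge0.
rewrite mulrCA ler_piMr// -powRD; last by rewrite pnatr_eq0 implybT.
rewrite -[leRHS](powRr0 2); apply: ler_powR; first by rewrite ler1n.
have -> : - (j%:R * (a + d%:R / 2)) + j%:R * (d%:R / 2) = - (j%:R * a) by ring.
by rewrite oppr_le0 mulr_ge0// ltW.
Qed.

(** The coarse and the detail part of the norm are each convex; the constant c
    contributes to the coarse part only, and the scaled wavelet sum only to the
    detail part, where its coefficients have weight at most e. *)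
Lemma holder_ball_perturb a (M' M t c e s : R) (p : space -> R) j :
  (J0 <= j)%N -> 0 <= t <= 1 -> 0 <= e -> `|s| <= 1 ->
  measurable_fun setT p -> holder_ball W a M' p ->
  (1 - t) * M' + t * coarse_norm W a (fun _ : space => c) + e <= M ->
  holder_ball W a M (fun x => (1 - t) * p x + t * c +
    s * (e * 2 `^ (- (j%:R * (a + d%:R / 2))) * wave_sum W j x)).
Proof.
move=> jJ t01 e0 s1 mp [ucp hp] hM; move/andP: (t01) => [t0 t1].
set u := e * 2 `^ _.
have [Bp hBp] := unif_continuous_bounded ucp.
have bp : ess_bdd U p := cube_ess_bdd mp hBp.
have bg := wave_sum_ess_bdd W d jJ.
have bpc : ess_bdd U (fun x => (1 - t) * p x + t * c).
  by apply: ess_bddD; [exact: ess_bddZ|exact: ess_bdd_cst].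
have innerP h : ess_bdd U h ->
    inner (fun x => (1 - t) * p x + t * c + s * (u * wave_sum W j x)) h =
    (1 - t) * inner p h + t * inner (cst c) h + s * u * inner (wave_sum W j) h.
  move=> bh.
  transitivity (inner (fun x => ((1 - t) * p x + t * c) + (s * u) * wave_sum W j x) h).
    by congr inner; apply/funext => x; ring.
  rewrite inner_lin//; congr (_ + _).
  have bc : ess_bdd U (cst c) by exact: ess_bdd_cst.
  transitivity (inner (fun x => (1 - t) * p x + t * cst c x) h); first by [].
  rewrite inner_lin//; last exact: ess_bddZ.
  congr (_ + _); rewrite !inner_expect//; last exact: ess_bddZ.
  by rewrite -expectZ; [apply: eq_Rintegral => x _; ring|exact: ess_bddM].
have uc' : unif_continuous_cube (fun x => (1 - t) * p x + t * c + s * (u * wave_sum W j x)).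
  apply: uc_add; first apply: uc_add; last 2 first.
  - exact: uc_cst.
  - by apply: uc_mul; [exact: uc_cst|apply: uc_mul; [exact: uc_cst|exact: wave_sum_uc]].
  - by apply: uc_mul; [exact: uc_cst|].
split => //.
set q := fun x => _.
have coarse_le : coarse_norm W a q <=
    (1 - t) * coarse_norm W a p + t * coarse_norm W a (fun _ : space => c).
  rewrite /coarse_norm; set w := 2 `^ _.
  set m1 := \big[_/_]_(m : loc d J0) `|inner p _|.
  set m2 := \big[_/_]_(m : loc d J0) `|inner (fun=> c) _|.
  have -> : (1 - t) * (w * m1) + t * (w * m2) = w * ((1 - t) * m1 + t * m2) by ring.
  rewrite ler_wpM2l ?powR_ge0//; apply: bigmax_le.
    by rewrite addr_ge0// mulr_ge0 ?subr_ge0//; exact: bigmax_ge_id.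
  move=> m _; rewrite innerP; last exact: Phi_ess_bdd.
  rewrite inner_wave_sum_Phi// mulr0 addr0 (le_trans (ler_normD _ _))//.
  rewrite !normrM (ger0_norm t0) ger0_norm ?subr_ge0//.
  by apply: lerD; rewrite ler_wpM2l ?subr_ge0//; exact: le_bigmax.
have c0 := coarse_norm_ge0 a p.
have detail_p l (iota : {ffun 'I_d -> bool}) (m : loc d l) :
    (J0 <= l)%N -> iota != [ffun=> false] ->
    2 `^ (l%:R * (a + d%:R / 2)) * `|inner p (Psi W iota m)| <= M' - coarse_norm W a p.
  move=> lJ iota0; rewrite lerBrDl -lee_fin EFinD; apply: le_trans hp.
  by rewrite leeD2l//; apply: ereal_sup_ubound; exists l, iota, m.
have detail_le : (detail_norm W a q <= ((1 - t) * (M' - coarse_norm W a p) + e)%:E)%E.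
  apply: ge_ereal_sup => v [l [iota [m [lJ iota0 ->]]]]; rewrite lee_fin.
  rewrite innerP; last exact: Psi_ess_bdd.
  rewrite inner_cst_Psi// mulr0 addr0.
  set w := 2 `^ _; have w0 : 0 <= w by exact: powR_ge0.
  apply: (@le_trans _ _ (w * ((1 - t) * `|inner p (Psi W iota m)|) +
      w * (u * `|inner (wave_sum W j) (Psi W iota m)|))).
    rewrite -mulrDr ler_wpM2l// (le_trans (ler_normD _ _))// lerD//.
      by rewrite normrM ger0_norm// subr_ge0.
    rewrite normrM ler_wpM2r// normrM [X in _ * X]ger0_norm; last first.
      by rewrite mulr_ge0 ?powR_ge0.
    by rewrite ler_piMl// mulr_ge0 ?powR_ge0.
  apply: lerD.
    by rewrite mulrCA ler_wpM2l ?subr_ge0//; exact: detail_p.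
  have := inner_wave_sum_Psi W m jJ lJ iota0; have [jl|jl] := eqVneq j l; last first.
    by rewrite normr_le0 => /eqP ->; rewrite normr0 !mulr0.
  move=> h; rewrite mulrA; apply: (@le_trans _ _ (w * u * 1)).
    by rewrite ler_wpM2l// mulr_ge0// mulr_ge0 ?powR_ge0.
  rewrite mulr1 /u mulrCA /w jl -powRD; last by rewrite pnatr_eq0 implybT.
  by rewrite subrr powRr0 mulr1.
apply: (@le_trans _ _ (((1 - t) * coarse_norm W a p +
   t * coarse_norm W a (fun _ : space => c)) +
   ((1 - t) * (M' - coarse_norm W a p) + e))%:E).
  by rewrite EFinD leeD// lee_fin.
rewrite lee_fin; apply: le_trans hM; lra.
Qed.

Lemma range_norm (C1 C2 x : R) : C1 <= x <= C2 -> `|x| <= Num.max `|C1| `|C2|.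
Proof.
move=> /andP[h1 h2]; rewrite ler_norml; apply/andP; split.
  apply: le_trans h1; rewrite lerNl (le_trans (ler_norm _))// normrN.
  by rewrite le_max lexx.
by rewrite (le_trans h2)// (le_trans (ler_norm _))// le_max lexx orbT.
Qed.

Section model_member.
Variables (C1 C2 al be M : R) (P : probability (obs R d) R).
Hypothesis PM : model W C1 C2 al be M P.

Lemma model_law : has_law P U (@obsX R d).
Proof. by case: PM. Qed.

Lemma model_range : {ae P, forall z, `|obsA z| <= Num.max `|C1| `|C2|} /\
  {ae P, forall z, `|obsY z| <= Num.max `|C1| `|C2|}.
Proof.
case: PM => _ hA hY _ _.
by split; [apply: filterS hA => z; exact: range_norm|
           apply: filterS hY => z; exact: range_norm].
Qed.

End model_member.

(** The slack M - M' pays for shrinking by t and for a perturbation of size e.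
    The alternating sum of the residual form over the four choices of signs
    retains only the interaction of the perturbations, 4 e^2 2^(-j(al + be)),
    so the bias of at least one choice is a quarter of it or more. *)
Lemma mse_lower_bound (C1 C2 al be M M' : R) (P0 : probability (obs R d) R) :
  C1 < C2 -> 0 < al -> 0 < be -> M' < M -> model W C1 C2 al be M' P0 ->
  exists2 kap : R, 0 < kap & forall j n, (J0 <= j)%N -> (0 < n)%N ->
    exists2 P : probability (obs R d) R, model W C1 C2 al be M P &
      (((kap * (2 `^ (- (al + be))) ^+ j) ^+ 2)%:E <= mse W j n P)%E.
Proof.
move=> C12 al0 be0 MM PM.
have XP := model_law PM; have [AB YB] := model_range PM.
have [_ hA hY [p [pA hp]] [b [bY hb]]] := PM.
have mp : measurable_fun setT p by case: pA.
have mb : measurable_fun setT b by case: bY.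
have [Bp hBp] := unif_continuous_bounded hp.1.
have [Bb hBb] := unif_continuous_bounded hb.1.
have bp : ess_bdd U p := cube_ess_bdd mp hBp.
have bb : ess_bdd U b := cube_ess_bdd mb hBb.
have bA : ess_bdd P0 (@obsA R d) by exact: ae_bounded_ess_bdd (@measurable_obsA R d) AB.
have bY' : ess_bdd P0 (@obsY R d) by exact: ae_bounded_ess_bdd (@measurable_obsY R d) YB.
pose c := (C1 + C2) / 2.
pose Ka := coarse_norm W al (fun _ : space => c).
pose Kb := coarse_norm W be (fun _ : space => c).
have Ka0 : 0 <= Ka by exact: coarse_norm_ge0.
have Kb0 : 0 <= Kb by exact: coarse_norm_ge0.
have [K K0 hK] := wave_sum_bound W d.
pose D := 2 * (Ka + Kb + `|M'| + 1).
have D0 : 0 < D by have := normr_ge0 M'; rewrite /D; lra.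
pose t := Num.min 1 ((M - M') / D).
have MM0 : 0 < M - M' by rewrite subr_gt0.
have t0 : 0 < t by rewrite lt_min ltr01 divr_gt0.
have t1 : t <= 1 by rewrite ge_min lexx.
have t01 : 0 <= t <= 1 by rewrite (ltW t0).
have tD : t * D <= M - M' by rewrite -ler_pdivlMr// ge_min lexx orbT.
pose w := t * ((C2 - C1) / 2).
have w0 : 0 < w by rewrite mulr_gt0// divr_gt0// subr_gt0.
pose e := Num.min ((M - M') / 2) (w / (K + 1)).
have K1 : 0 < K + 1 by lra.
have e0 : 0 < e by rewrite lt_min !divr_gt0.
have eM : e <= (M - M') / 2 by rewrite ge_min lexx.
have eK : e * K <= w.
  apply: (@le_trans _ _ (e * (K + 1))); first by rewrite ler_wpM2l ?(ltW e0)//; lra.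
  by rewrite -ler_pdivlMr// ge_min lexx orbT.
have radius k : 0 <= k -> k <= Ka + Kb -> (1 - t) * M' + t * k + e <= M.
  move=> k0 kK; have h : t * (2 * (k - M')) <= t * D.
    by rewrite ler_wpM2l ?(ltW t0)// /D; have := ler_norm (- M'); rewrite normrN; lra.
  have : 2 * (t * (k - M')) = t * (2 * (k - M')) by ring.
  lra.
exists (e ^+ 2); first by rewrite exprn_gt0.
move=> j n jJ n0.
pose g := wave_sum W (d := d) j.
have mg : measurable_fun setT g by exact: measurable_wave_sum.
have bg : ess_bdd U g by exact: wave_sum_ess_bdd.
pose ua := e * 2 `^ (- (j%:R * (al + d%:R / 2))).
pose ub := e * 2 `^ (- (j%:R * (be + d%:R / 2))).
pose p1 x := (1 - t) * p x + t * c.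
pose b1 x := (1 - t) * b x + t * c.
have bp1 : ess_bdd U p1.
  by apply: ess_bddD; [exact: ess_bddZ|exact: ess_bdd_cst].
have bb1 : ess_bdd U b1.
  by apply: ess_bddD; [exact: ess_bddZ|exact: ess_bdd_cst].
pose rf s1 s2 := resid_form W j (fun x => p1 x + s1 * (ua * g x))
  (fun x => b1 x + s2 * (ub * g x)).
have mem s1 s2 : `|s1| <= 1 -> `|s2| <= 1 ->
    exists2 P : probability (obs R d) R, model W C1 C2 al be M P & ((rf s1 s2 ^+ 2)%:E <= mse W j n P)%E.
  move=> hs1 hs2.
  pose phi x := s1 * (ua * g x); pose chi x := s2 * (ub * g x).
  have mphi : measurable_fun setT phi by do 2 apply: measurable_funM => //.
  have mchi : measurable_fun setT chi by do 2 apply: measurable_funM => //.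
  have bphi : ess_bdd U phi by do 2 apply: ess_bddZ.
  have bchi : ess_bdd U chi by do 2 apply: ess_bddZ.
  have rphi x : cube x -> `|phi x| <= w.
    move=> _; rewrite normrM -[leRHS]mul1r ler_pM//; apply: le_trans eK.
    by apply: wave_sum_ball_range => //; [exact: ltW|exact: hK].
  have rchi x : cube x -> `|chi x| <= w.
    move=> _; rewrite normrM -[leRHS]mul1r ler_pM//; apply: le_trans eK.
    by apply: wave_sum_ball_range => //; [exact: ltW|exact: hK].
  pose P := shift_prob P0 C1 C2 t mphi mchi.
  have XP' : has_law P U (@obsX R d) := shift_obsX_law C1 C2 t mphi mchi XP.
  have pA' := shift_cond_exp (C1 := C1) (C2 := C2) (t := t) mphi mchi XP
    (@measurable_obsA R d) bA bp bphi (fun=> erefl) pA.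
  have bY'' := shift_cond_exp (C1 := C1) (C2 := C2) (t := t) mphi mchi XP
    (@measurable_obsY R d) bY' bb bchi (fun=> erefl) bY.
  have hA' := shift_range t01 mphi mchi XP (@measurable_obsA R d) rphi (fun=> erefl) hA.
  have hY' := shift_range t01 mphi mchi XP (@measurable_obsY R d) rchi (fun=> erefl) hY.
  have PM' : model W C1 C2 al be M P.
    split => //.
    - eexists; split; [exact: pA'|]; apply: holder_ball_perturb => //.
      + exact: ltW.
      + exact: hp.
      + by apply: radius => //; rewrite lerDl.
    - eexists; split; [exact: bY''|]; apply: holder_ball_perturb => //.
      + exact: ltW.
      + exact: hb.
      + by apply: radius => //; rewrite lerDr.
  exists P => //; have [AB' YB'] := model_range PM'.
  exact: (mse_ge_resid W XP' AB' YB' pA' bY'' (ess_bddD bp1 bphi)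
    (ess_bddD bb1 bchi) jJ n0).
have rfE s1 s2 : rf s1 s2 = resid_form W j p1 b1 + s2 * ub * resid_form W j p1 g +
    s1 * ua * (resid_form W j g b1 + s2 * ub * resid_form W j g g).
  have linr q : ess_bdd U q -> resid_form W j q (fun x => b1 x + s2 * (ub * g x)) =
      resid_form W j q b1 + s2 * ub * resid_form W j q g.
    move=> bq; rewrite resid_formC.
    transitivity (resid_form W j (fun x => b1 x + s2 * ub * g x) q).
      by congr resid_form; apply/funext => x; ring.
    by rewrite resid_form_lin// !(resid_formC _ q).
  rewrite -!linr// -resid_form_lin//.
    by congr resid_form; apply/funext => x; ring.
  by apply: ess_bddD => //; do 2 apply: ess_bddZ.
pose q := e ^+ 2 * 2 `^ (- (al + be)) ^+ j.
have q0 : 0 <= q by rewrite mulr_ge0 ?exprn_ge0 ?powR_ge0 ?(ltW e0).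
have polar : rf 1 1 - rf 1 (-1) - rf (-1) 1 + rf (-1) (-1) = 4 * q.
  rewrite !rfE resid_wave_sum//.
  have -> : q = ua * ub * 2 ^+ (j * d).
    have key : (2 `^ (- (al + be))) ^+ j = 2 `^ (- (j%:R * (al + d%:R / 2))) *
        2 `^ (- (j%:R * (be + d%:R / 2))) * 2 ^+ (j * d).
      rewrite -[LHS]powR_mulrn ?powR_ge0// -powRrM.
      rewrite -[2 ^+ (j * d)]powR_mulrn// -!powRD; [|by rewrite pnatr_eq0 implybT..].
      by congr (_ `^ _); rewrite natrM; field.
    rewrite /q key /ua /ub; ring.
  ring.
have pick s1 s2 : `|s1| <= 1 -> `|s2| <= 1 -> q <= `|rf s1 s2| ->
    exists2 P : probability (obs R d) R, model W C1 C2 al be M P & ((q ^+ 2)%:E <= mse W j n P)%E.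
  move=> hs1 hs2 hq; have [P PM' hP] := mem s1 s2 hs1 hs2; exists P => //.
  apply: le_trans hP; rewrite lee_fin -(real_normK (num_real (rf s1 s2))).
  by rewrite ler_pXn2r// nnegrE.
have n1 : `|1 : R| <= 1 by rewrite normr1.
have nm1 : `|-1 : R| <= 1 by rewrite normrN normr1.
have [h1|h1] := leP q `|rf 1 1|; first exact: pick h1.
have [h2|h2] := leP q `|rf 1 (-1)|; first exact: pick h2.
have [h3|h3] := leP q `|rf (-1) 1|; first exact: pick h3.
have [h4|h4] := leP q `|rf (-1) (-1)|; first exact: pick h4.
move: polar h1 h2 h3 h4; clearbody q rf.
move: (rf 1 1) (rf 1 (-1)) (rf (-1) 1) (rf (-1) (-1)); clear => r1 r2 r3 r4.
by rewrite !ltr_norml => ? /andP[? ?] /andP[? ?] /andP[? ?] /andP[? ?]; lra.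
Qed.

End lower_bound.

(** * From resolutions to sample sizes *)

Section rates.
Variable R : realType.

Lemma powRN_anti (x y r : R) : 0 < y -> y <= x -> 0 <= r -> x `^ (- r) <= y `^ (- r).
Proof.
move=> y0 yx r0; have x0 := lt_le_trans y0 yx.
rewrite !powRN lef_pV2 ?posrE ?powR_gt0//.
by apply: ge0_ler_powR => //; rewrite nnegrE ltW.
Qed.

(** A decay in the level j rewritten as a power of the dimension 2^(jd). *)
Lemma dyadic_decay (a : R) d j : (0 < d)%N ->
  ((2 `^ (- a)) ^+ j) ^+ 2 = (2 ^+ (j * d)) `^ (- (2 * a / d%:R)) :> R.
Proof.
move=> d0; have d0' : d%:R != 0 :> R by rewrite pnatr_eq0 -lt0n.
rewrite -exprM -powR_mulrn ?powR_ge0// -powRrM -powR_mulrn// -powRrM.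
by congr (_ `^ _); rewrite !natrM; field.
Qed.

Lemma powR_unbounded (a C : R) : 0 < a ->
  ~ (\forall n \near \oo, (n%:R : R) `^ a <= C).
Proof.
move=> a0 near_le; pose x := (`|C| + 1) `^ (a^-1).
have C0 : 0 < `|C| + 1 by have := normr_ge0 C; lra.
have [n [h xn]] : exists n : nat, n%:R `^ a <= C /\ x <= n%:R.
  have : \forall n \near \oo, n%:R `^ a <= C /\ x <= n%:R.
    near=> n; split; near: n => //; exact: nbhs_infty_ger.
  by move=> /filter_ex.
have : x `^ a <= n%:R `^ a.
  by apply: (ge0_ler_powR (ltW a0)) => //; rewrite nnegrE ?powR_ge0.
rewrite -powRrM mulVf ?gt_eqF// powRr1 ?(ltW C0)//.
by have := ler_norm C; lra.
Unshelve. all: by end_near. Qed.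

End rates.

Theorem corollary8 (R : realType) (d S J0 : nat) (W : cdv_basis R S J0)
    (C1 C2 alpha beta M c2 : R) (j : nat -> nat)
    (d_gt0 : (0 < d)%N) (S_ge1 : (1 <= S)%N) (J0S : (S <= 2 ^ J0)%N)
    (alpha_gt0 : 0 < alpha) (beta_gt0 : 0 < beta) (M_gt0 : 0 < M)
    (S_gt : Num.max alpha beta < S%:R)
    (C12 : C1 < C2)
    (M_nondeg : exists2 M' : R, M' < M &
       @model R d S J0 W C1 C2 alpha beta M' !=set0)
    (c2_gt0 : 0 < c2)
    (jJ0 : forall n, (J0 <= j n)%N)
    (k_pred : asymp (fun n => (2 ^+ (j n * d))%:E)
       (fun n => (c2 * n%:R `^ (d%:R / (2 * beta + d%:R)))%:E)) :
  @minimax_rate_optimal R d S J0 W C1 C2 alpha beta M j <->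
  d%:R / 2 <= alpha.
Proof.
have d0 : 0 < d%:R :> R by rewrite ltr0n.
have [[Ca Ca0 k_le] [Cb Cb0 k_ge]] := k_pred.
set theta := d%:R / (2 * beta + d%:R) in k_le k_ge.
have bd0 : 0 < 2 * beta + d%:R by lra.
have ab0 : 0 < alpha + beta by lra.
pose r := 2 * (alpha + beta) / d%:R.
have r0 : 0 < r by rewrite divr_gt0// mulr_gt0.
pose x := 2 * (alpha + beta) / (2 * beta + d%:R).
have x0 : 0 < x by rewrite divr_gt0// mulr_gt0.
have thr : theta * r = x.
  by rewrite /theta /r /x; field; rewrite !gt_eqF.
split => [[C C0 opt]|ad].
- rewrite leNgt; apply/negP => ad.
  have [M' MM [P0 PM0]] := M_nondeg.
  have [kap kap0 low] :=
    mse_lower_bound d_gt0 S_ge1 C12 alpha_gt0 beta_gt0 MM PM0.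
  pose y := if d%:R / 4 <= (alpha + beta) / 2 then 1
    else (4 * alpha + 4 * beta) / (2 * alpha + 2 * beta + d%:R).
  have rateE n : rate d alpha beta n = n%:R `^ (- y).
    by rewrite /rate /y; case: ifP => // _; rewrite powR_inv1.
  have xy : 0 < y - x.
    rewrite /y /x subr_gt0; case: ifP => _; first by rewrite ltr_pdivrMr//; lra.
    have abd0 : 0 < 2 * alpha + 2 * beta + d%:R by lra.
    rewrite ltr_pdivrMr// mulrAC ltr_pdivlMr//.
    have -> : (4 * alpha + 4 * beta) * (2 * beta + d%:R) =
      2 * (alpha + beta) * (4 * beta + 2 * d%:R) by ring.
    by rewrite ltr_pM2l ?mulr_gt0//; lra.
  pose m := kap ^+ 2 * (Ca * c2) `^ (- r).
  have m0 : 0 < m by rewrite mulr_gt0 ?exprn_gt0// powR_gt0// mulr_gt0.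
  have {}opt : \forall n \near \oo, forall P : probability (obs R d) R,
      model W C1 C2 alpha beta M P ->
      (mse W (j n) n P <= C%:E * (rate d alpha beta n)%:E)%E.
    apply: filterS opt => n hn P PM; apply: le_trans hn.
    by apply: ereal_sup_ubound; exists P.
  apply: (@powR_unbounded R (y - x) (C / m) xy).
  near=> n.
  have n0 : (0 < n)%N by near: n; exact: nbhs_infty_gt.
  have n0' : 0 < n%:R :> R by rewrite ltr0n.
  have kn : (2 ^+ (j n * d) : R) <= Ca * (c2 * n%:R `^ theta).
    by rewrite -lee_fin EFinM; near: n.
  have optn (P : probability (obs R d) R) : model W C1 C2 alpha beta M P ->
      (mse W (j n) n P <= C%:E * (rate d alpha beta n)%:E)%E.
    by move: P; near: n.
  have [P PM hP] := low (j n) n (jJ0 n) n0.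
  have : kap ^+ 2 * (2 ^+ (j n * d)) `^ (- r) <= C * n%:R `^ (- y).
    rewrite -dyadic_decay// -exprMn -rateE -lee_fin EFinM.
    exact: le_trans hP (optn P PM).
  have : (Ca * c2) `^ (- r) * n%:R `^ (- x) <= (2 ^+ (j n * d)) `^ (- r).
    have -> : (Ca * c2) `^ (- r) * n%:R `^ (- x) =
        (Ca * (c2 * n%:R `^ theta)) `^ (- r).
      rewrite mulrA [RHS]powRM ?powR_ge0//; last by rewrite ltW// mulr_gt0.
      by rewrite -powRrM mulrN thr.
    exact: powRN_anti (exprn_gt0 _ _) kn (ltW r0).
  rewrite -(ler_pM2l (exprn_gt0 2 kap0)) mulrA -/m => h1 /(le_trans h1).
  rewrite ler_pdivlMr// powRB; last by rewrite pnatr_eq0 -lt0n n0 implybT.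
  rewrite !powRN => h2.
  have nx : 0 < n%:R `^ x by exact: powR_gt0.
  have ny : 0 < n%:R `^ y by exact: powR_gt0.
  move: h2; rewrite -(ler_pM2r ny) -mulrA divfK ?gt_eqF//.
  by congr (_ <= _); ring.
- have rateE n : rate d alpha beta n = n%:R^-1.
    by rewrite /rate ifT//; lra.
  pose B := Num.max `|C1| `|C2|.
  pose D := 2 ^+ d * M ^+ 2 / (1 - 2 `^ (- (alpha + beta))).
  pose C := D ^+ 2 * (c2 / Cb) `^ (- r) + 5 * B ^+ 4 + 2 * B ^+ 4 * (Ca * c2) + 1.
  have B4 : 0 <= B ^+ 4 by rewrite exprn_even_ge0.
  have C0 : 0 < C.
    have h1 : 0 <= D ^+ 2 * (c2 / Cb) `^ (- r).
      exact: mulr_ge0 (sqr_ge0 D) (powR_ge0 _ _).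
    have h2 : 0 <= B ^+ 4 * (Ca * c2).
      exact: mulr_ge0 B4 (ltW (mulr_gt0 Ca0 c2_gt0)).
    by rewrite /C -[2 * _ * _]mulrA; lra.
  exists C => //; near=> n.
  have n0 : (0 < n)%N by near: n; exact: nbhs_infty_gt.
  have n0' : 0 < n%:R :> R by rewrite ltr0n.
  have n1 : 1 <= n%:R :> R by rewrite ler1n.
  have kn : (2 ^+ (j n * d) : R) <= Ca * (c2 * n%:R `^ theta).
    by rewrite -lee_fin EFinM; near: n.
  have kn' : c2 * n%:R `^ theta <= Cb * (2 ^+ (j n * d) : R).
    by rewrite -lee_fin [leRHS]EFinM; near: n.
  rewrite rateE; apply: ge_ereal_sup => _ [P PM <-].
  have XP := model_law PM; have [AB YB] := model_range PM.
  have [_ _ _ [p [pA hp]] [b [bY hb]]] := PM.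
  have mp : measurable_fun setT p by case: pA.
  have mb : measurable_fun setT b by case: bY.
  have [Bp hBp] := unif_continuous_bounded hp.1.
  have [Bb hBb] := unif_continuous_bounded hb.1.
  apply: le_trans (mse_le_resid W XP AB YB pA bY (cube_ess_bdd mp hBp)
    (cube_ess_bdd mb hBb) (jJ0 n) n0) _.
  rewrite -EFinM lee_fin -/B.
  have bias : resid_form W (j n) p b ^+ 2 <= D ^+ 2 * (c2 / Cb) `^ (- r) / n%:R.
    have h := resid_form_le S_ge1 ab0 (jJ0 n) mp mb hp hb.
    rewrite -(real_normK (num_real (resid_form _ _ _ _))).
    apply: (@le_trans _ _ ((D * (2 `^ (- (alpha + beta))) ^+ j n) ^+ 2)).
      by rewrite lerXn2r// nnegrE// (le_trans _ h).
    rewrite exprMn -mulrA ler_wpM2l ?sqr_ge0// (dyadic_decay _ _ d_gt0) -/r.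
    apply: (@le_trans _ _ ((c2 / Cb * n%:R `^ theta) `^ (- r))).
      have c0 : 0 < c2 / Cb * n%:R `^ theta by rewrite mulr_gt0 ?powR_gt0// divr_gt0.
      apply: powRN_anti c0 _ (ltW r0).
      by rewrite mulrAC ler_pdivrMr// [leRHS]mulrC.
    rewrite [leLHS]powRM ?powR_ge0//; last by rewrite ltW// divr_gt0.
    rewrite ler_wpM2l ?powR_ge0// -powRrM mulrN thr -powR_inv1//.
    apply: ler_powR => //; rewrite lerN2 ler_pdivlMr// mul1r.
    by have : d%:R <= 2 * alpha; [rewrite mulrC -ler_pdivrMr|lra].
  have var : 2 * B ^+ 4 * 2 ^+ (j n * d) / n%:R ^+ 2 <=
      2 * B ^+ 4 * (Ca * c2) / n%:R.
    have -> : 2 * B ^+ 4 * (Ca * c2) / n%:R =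
        2 * B ^+ 4 * (Ca * (c2 * n%:R)) / n%:R ^+ 2.
      by field; rewrite gt_eqF.
    have B42 : 0 <= 2 * B ^+ 4 := mulr_ge0 (ler0n _ 2) B4.
    rewrite ler_wpM2r ?invr_ge0 ?exprn_ge0// ler_wpM2l//.
    apply: le_trans kn _; rewrite !ler_wpM2l ?(ltW Ca0) ?(ltW c2_gt0)//.
    rewrite -[leRHS](powRr1 (ltW n0')); apply: ler_powR => //.
    by rewrite ler_pdivrMr// mul1r lerDr mulr_ge0// ltW.
  have ninv : 0 <= n%:R^-1 :> R by rewrite invr_ge0.
  have -> : C / n%:R = D ^+ 2 * (c2 / Cb) `^ (- r) / n%:R + 5 * B ^+ 4 / n%:R +
      2 * B ^+ 4 * (Ca * c2) / n%:R + n%:R^-1 by rewrite /C; ring.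
  rewrite -[leLHS]addr0; apply: lerD ninv; apply: lerD var.
  by rewrite lerD2r.
Unshelve. all: by end_near. Qed.
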